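(* There exists a spherically symmetric $f_0\in\mathfrak{P}_3\cap\mathfrak{C}^1$ such that $$\mathcal{E}(f_0)=0,\qquad \mathcal{V}(f_0)<-\tfrac12,\qquad \|f_0\|_{3/2}>\frac38\left(\frac{15}{16}\right)^{1/3}.$$
   Context: Points of $\mathbb{R}^6$ are written $(p,q)$ with momentum $p\in\mathbb{R}^3$ and position $q\in\mathbb{R}^3$, and $d\mu=d^3p\,d^3q$ is Lebesgue measure. $\mathfrak{P}_3\cap\mathfrak{C}^1$ denotes the set of probability measures on $\mathbb{R}^6$ whose first three moments are finite, that are absolutely continuous with respect to Lebesgue measure, and whose density is of class $C^1$; such a measure is identified with its density. So $f\ge 0$, $f\in C^1(\mathbb{R}^6)$, $\int f\,d\mu=1$, and $\int (|p|+|q|)^k f\,d\mu<\infty$ for $k=1,2,3$. Spherically symmetric means $f(Op,Oq)=f(p,q)$ for all rotations $O$ of $\mathbb{R}^3$ and all $(p,q)$. Total energy: $$\mathcal{E}(f)=\int\sqrt{1+|p|^2}\,f(p,q)\,d\mu-\frac12\iint\frac{f(p',q')f(p,q)}{|q-q'|}\,d\mu\,d\mu'.$$ Virial: $\mathcal{V}(f)=\int (q\cdot p)\,f(p,q)\,d\mu$. Norm: $\|f\|_{3/2}=\left(\int |f|^{3/2}\,d\mu\right)^{2/3}$. *)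

(* Defs.v *)
From HB Require Import structures.
From mathcomp Require Import all_boot all_order all_algebra.
From mathcomp Require Import all_classical all_reals all_analysis.
Set Implicit Arguments.
Unset Strict Implicit.
Unset Printing Implicit Defensive.
Import Order.TTheory GRing.Theory Num.Theory.
Import numFieldNormedType.Exports.
Local Open Scope classical_set_scope.
Local Open Scope ring_scope.

(* The products carry the sup norm and the product sigma-algebra.  On R^3 and
   R^6 these give the usual topology and the usual Borel sets; the Euclidean
   length is [enorm] below. *)
Notation vec3 R := (R * R * R)%type.
Notation phase R := (vec3 R * vec3 R)%type.

Section Euclidean3.
Context {R : realType}.
Implicit Types x y : vec3 R.

Definition dot x y : R := x.1.1 * y.1.1 + x.1.2 * y.1.2 + x.2 * y.2.

Definition enorm x : R := Num.sqrt (dot x x).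

Definition col_of_vec x : 'cV[R]_3 := \col_i [:: x.1.1; x.1.2; x.2]`_i.

Definition vec_of_col (u : 'cV[R]_3) : vec3 R := ((u 0 0, u 1 0), u 2 0).

Definition rotation (O : 'M[R]_3) : Prop := O *m O^T = 1%:M /\ \det O = 1.

Definition rotv (O : 'M[R]_3) x : vec3 R := vec_of_col (O *m col_of_vec x).

End Euclidean3.

(* 'D_v f is x |-> 'd f x v; in finite dimension its continuity for every v is
   the continuity of x |-> 'd f x in operator norm. *)
Definition class_C1 {R : realType} {V : normedModType R} (f : V -> R) : Prop :=
  (forall x, differentiable f x) /\ (forall v, continuous ('D_v f)).

(* The library declares its sigma-finite structure on m1 \x m2 under a key that
   is already taken by the structure for subprobabilities, so that it is not
   inferred for Lebesgue measure; [sfprod] is m1 \x m2 with that structure. *)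
Section SigmaFiniteProduct.
Context {d1 d2 : measure_display} {T1 : measurableType d1}
  {T2 : measurableType d2} {R : realType}.
Variable m1 : {sigma_finite_measure set T1 -> \bar R}.
Variable m2 : {sigma_finite_measure set T2 -> \bar R}.

Definition sfprod : set (T1 * T2)%type -> \bar R := (m1 \x m2)%E.

HB.instance Definition _ := Measure.on sfprod.

Let sfprod_sigma_finite : sigma_finite setT sfprod.
Proof.
have /sigma_finiteP[F [TF ndF Foo]] := sigma_finiteT m1.
have /sigma_finiteP[G [TG ndG Goo]] := sigma_finiteT m2.
exists (fun n => F n `*` G n).
  rewrite -setXTT TF TG predeqE => -[x y]; split.
    move=> [/= [n _ Fnx] [k _ Gky]]; exists (maxn n k) => //; split.
    - by move: x Fnx; exact/subsetPset/ndF/leq_maxl.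
    - by move: y Gky; exact/subsetPset/ndG/leq_maxr.
  by move=> [n _ []/= ? ?]; split; exists n.
move=> k; have [? ?] := Foo k; have [? ?] := Goo k.
split; first exact: measurableX.
by rewrite /sfprod product_measure1E// lte_mul_pinfty// ge0_fin_numE.
Qed.

HB.instance Definition _ :=
  Measure_isSigmaFinite.Build _ _ _ sfprod sfprod_sigma_finite.

End SigmaFiniteProduct.

Definition lebesgue3 {R : realType} :
    {sigma_finite_measure set (vec3 (measurableTypeR R)) -> \bar R} :=
  sfprod (sfprod (@lebesgue_measure R) (@lebesgue_measure R)) (@lebesgue_measure R).

Definition lebesgue6 {R : realType} :
    {sigma_finite_measure set (phase (measurableTypeR R)) -> \bar R} :=
  sfprod (@lebesgue3 R) (@lebesgue3 R).

Section PhaseSpace.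
Context {R : realType}.
Implicit Types f : phase R -> R.

Local Open Scope ereal_scope.

Definition P3C1 f : Prop :=
  [/\ (forall x, 0 <= f x)%R,
      class_C1 f,
      \int[lebesgue6]_x (f x)%:E = 1
    & forall k : nat, (1 <= k <= 3)%N ->
        \int[lebesgue6]_x ((enorm x.1 + enorm x.2) ^+ k * f x)%:E < +oo].

Definition spherically_symmetric f : Prop :=
  forall O, rotation O -> forall p q, f (rotv O p, rotv O q) = f (p, q).

(* x = (p, q) and x' = (p', q').  On P3C1 the kinetic term is finite, so the
   difference is never +oo - +oo.  The inverse is 0 on the null set q = q'. *)
Definition energy f : \bar R :=
  \int[lebesgue6]_x (Num.sqrt (1 + enorm x.1 ^+ 2) * f x)%:E
  - (2^-1)%:E * \int[lebesgue6]_x' \int[lebesgue6]_x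
                  (f x' * f x / enorm (x.2 - x'.2))%:E.

Definition virial f : \bar R := \int[lebesgue6]_x (dot x.2 x.1 * f x)%:E.

End PhaseSpace.

(* Main.v *)
Require Import Defs.
From HB Require Import structures.
From mathcomp Require Import all_boot all_order all_algebra.
From mathcomp Require Import all_classical all_reals all_analysis.
From mathcomp Require Import measurable_realfun ring lra.
Import Order.TTheory GRing.Theory Num.Theory.
Import numFieldNormedType.Exports.
Local Open Scope classical_set_scope.
Local Open Scope ring_scope.
Local Open Scope ereal_scope.

(** The density is f(p, q) = h(p) rho(q) L(p . q) with h and rho radial mixtures
    of Gaussians and L(s) = 2 / (1 + e^s).  Since L(s) + L(-s) = 2, the factor L
    changes neither the marginals nor the kinetic energy, but it favours p . q < 0
    and makes the virial negative.

    Take rho = (G_e + G_1) / 2 and h = (1 - t) G_1 + t G_P, where G_s is the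
    centred Gaussian of standard deviation s.  For e small, the core G_e makes the
    potential energy u of order 1 / e.  The kinetic energy is affine in t, bounded
    at t = 0 and comparable to P at t = 1, so for P large some t <= 1 / 2 of order
    u / P gives total energy 0.  The fast particles in the unit cloud G_1 then
    contribute about - P t, of order - u, to the virial, whereas the slow particles
    in the core carry a fixed fraction of the mass in a phase volume of order e^3,
    which makes the 3/2-norm large. *)

(** * Closure properties of continuously differentiable functions *)

Section ClassC1.
Context {R : realType} {V : normedModType R}.
Local Open Scope ring_scope.
Implicit Types f g : V -> R.

Lemma class_C1_continuous f : class_C1 f -> continuous f.
Proof. by move=> [df _] x; exact: differentiable_continuous. Qed.

Lemma class_C1_cst (c : R) : class_C1 (fun _ : V => c).
Proof.
split=> [x|v]; first exact: differentiable_cst.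
rewrite (_ : 'D_v _ = fun=> 0); first by move=> x; exact: cvg_cst.
by apply/funext => x; rewrite derive_cst.
Qed.

Lemma class_C1_linear (l : {linear V -> R}) : continuous l -> class_C1 l.
Proof.
move=> cl; split=> [x|v]; first exact: linear_differentiable.
rewrite (_ : 'D_v l = fun=> l v); first by move=> x; exact: cvg_cst.
apply/funext => x; rewrite deriveE; last exact: linear_differentiable.
by rewrite diff_lin.
Qed.

Lemma class_C1D f g : class_C1 f -> class_C1 g -> class_C1 (fun x => f x + g x).
Proof.
move=> [df cf] [dg cg]; split=> [x|v]; first exact: differentiableD.
rewrite (_ : 'D_v _ = fun x => 'D_v f x + 'D_v g x); last first.
  by apply/funext => x; rewrite deriveD//; exact: diff_derivable.
by move=> x; apply: cvgD; [exact: cf|exact: cg].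
Qed.

Lemma class_C1M f g : class_C1 f -> class_C1 g -> class_C1 (fun x => f x * g x).
Proof.
move=> Cf Cg; have [[df cf] [dg cg]] := (Cf, Cg).
split=> [x|v]; first exact: differentiableM.
rewrite (_ : 'D_v _ = fun x => f x * 'D_v g x + g x * 'D_v f x); last first.
  by apply/funext => x; rewrite deriveM//; exact: diff_derivable.
move=> x; apply: cvgD; apply: cvgM; try exact: class_C1_continuous.
- exact: cg.
- exact: cf.
Qed.

Lemma class_C1V f : (forall x, f x != 0) -> class_C1 f ->
  class_C1 (fun x => (f x)^-1).
Proof.
move=> f0 Cf; have [df cf] := Cf.
split=> [x|v]; first exact: differentiableV.
rewrite (_ : 'D_v _ = fun x => - (f x) ^- 2 * 'D_v f x); last first.
  by apply/funext => x; rewrite deriveV//; exact: diff_derivable.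
move=> x; apply: cvgM; last exact: cf.
apply: cvgN; apply: cvgV; first by rewrite expf_neq0.
by apply: cvgM; exact: class_C1_continuous.
Qed.

Lemma class_C1_expR f : class_C1 f -> class_C1 (fun x => expR (f x)).
Proof.
move=> Cf; have [df cf] := Cf.
have de y : differentiable (expR : R -> R) y.
  exact/derivable1_diffP/derivable_expR.
split=> [x|v]; first exact: (@differentiable_comp _ _ _ _ f expR).
rewrite (_ : 'D_v _ = fun x => expR (f x) * 'D_v f x); last first.
  apply/funext => x; rewrite deriveE; last exact: (@differentiable_comp _ _ _ _ f expR).
  (* The differential of [expR] is linear on the line, so its value at a direction is that direction
     times its value at 1, the usual derivative. *)
  rewrite (@diff_comp _ _ _ _ f expR)//= -[X in 'd expR _ X]mulr1.
  by rewrite -[_ * 1]/(_ *: 1) linearZ/= -!deriveE// derive_val mulrC.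
move=> x; apply: cvgM; last exact: cf.
by apply: continuous_comp; [exact: class_C1_continuous|exact: continuous_expR].
Qed.

End ClassC1.

(** * The scalar product: smoothness and rotation invariance *)

Section Dot.
Context {R : realType}.
Local Open Scope ring_scope.

(** The scalar product is a polynomial in coordinates, and each coordinate of a continuous linear
    map is again continuous and linear. Two general maps [a] and [b] let one argument cover |p|^2,
    |q|^2 and p . q. *)
Lemma class_C1_dot {V : normedModType R} (a b : {linear V -> vec3 R}) :
  continuous a -> continuous b -> class_C1 (fun x => dot (a x) (b x)).
Proof.
pose c1 := (fst \o fst : {linear vec3 R -> R}).
pose c2 := (snd \o fst : {linear vec3 R -> R}).
pose c3 := (snd : {linear vec3 R -> R}).
have k1 : continuous c1.
  by move=> x; apply: continuous_comp; exact: cvg_fst.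
have k2 : continuous c2.
  by move=> x; apply: continuous_comp; [exact: cvg_fst|exact: cvg_snd].
have k3 : continuous c3 by move=> x; exact: cvg_snd.
have C (c : {linear vec3 R -> R}) (l : {linear V -> vec3 R}) :
    continuous c -> continuous l -> class_C1 (fun x => c (l x)).
  move=> kc kl; apply: (@class_C1_linear _ _ (c \o l : {linear V -> R})) => x.
  by apply: continuous_comp; [exact: kl|exact: kc].
move=> ka kb; rewrite /dot.
by repeat apply: class_C1D; apply: class_C1M;
  first [exact: (C c1)|exact: (C c2)|exact: (C c3)].
Qed.

Lemma class_C1_dot_fst : class_C1 (fun x : phase R => dot x.1 x.1).
Proof.
by apply: (@class_C1_dot (phase R) (fst : {linear phase R -> vec3 R})
  (fst : {linear phase R -> vec3 R})) => x; exact: cvg_fst.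
Qed.

Lemma class_C1_dot_snd : class_C1 (fun x : phase R => dot x.2 x.2).
Proof.
by apply: (@class_C1_dot (phase R) (snd : {linear phase R -> vec3 R})
  (snd : {linear phase R -> vec3 R})) => x; exact: cvg_snd.
Qed.

Lemma class_C1_dot_fst_snd : class_C1 (fun x : phase R => dot x.1 x.2).
Proof.
by apply: (@class_C1_dot (phase R) (fst : {linear phase R -> vec3 R})
  (snd : {linear phase R -> vec3 R})) => x; [exact: cvg_fst|exact: cvg_snd].
Qed.

Lemma dot_col (x y : vec3 R) : (col_of_vec x)^T *m col_of_vec y = (dot x y)%:M.
Proof.
apply/matrixP => i j; rewrite !ord1 !mxE !big_ord_recl big_ord0 !mxE/= /dot.
by rewrite addr0 addrA mulr1n.
Qed.

Lemma col_of_rotv (O : 'M[R]_3) x : col_of_vec (rotv O x) = O *m col_of_vec x.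
Proof.
apply/matrixP => i j; rewrite !ord1 !mxE /rotv/=.
case: i => -[|[|[|//]]] /= Hi; rewrite mxE; apply: eq_bigr => k _;
  by congr (O _ _ * _); exact: val_inj.
Qed.

Lemma dot_rotv (O : 'M[R]_3) x y : rotation O -> dot (rotv O x) (rotv O y) = dot x y.
Proof.
move=> [OO _]; have /matrixP/(_ 0 0) :
    (dot (rotv O x) (rotv O y))%:M = (dot x y)%:M :> 'M[R]_1.
  rewrite -!dot_col !col_of_rotv trmx_mul mulmxA -(mulmxA _ O^T).
  (* [rotation] provides [O *m O^T = 1]; for square matrices the other order follows, and it is the
     one that appears between the two columns. *)
  by rewrite (mulmx1C OO) mulmx1.
by rewrite !mxE !mulr1n.
Qed.

End Dot.

(** * Tonelli and image measures for sigma-finite products *)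

Section Sfprod.
Context {d1 d2 : measure_display} {T1 : measurableType d1}
  {T2 : measurableType d2} {R : realType}.
Variable m1 : {sigma_finite_measure set T1 -> \bar R}.
Variable m2 : {sigma_finite_measure set T2 -> \bar R}.

Lemma sfprodX A B : measurable A -> measurable B ->
  sfprod m1 m2 (A `*` B) = m1 A * m2 B.
Proof. exact: product_measure1E. Qed.

Lemma ge0_integral_sfprod1 (F : T1 * T2 -> \bar R) :
  measurable_fun setT F -> (forall z, 0 <= F z) ->
  \int[sfprod m1 m2]_z F z = \int[m1]_x \int[m2]_y F (x, y).
Proof. exact: fubini_tonelli1. Qed.

Lemma ge0_integral_sfprod2 (F : T1 * T2 -> \bar R) :
  measurable_fun setT F -> (forall z, 0 <= F z) ->
  \int[sfprod m1 m2]_z F z = \int[m2]_y \int[m1]_x F (x, y).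
Proof. exact: fubini_tonelli2. Qed.

Lemma ge0_integral_sfprodM (f : T1 -> \bar R) (g : T2 -> \bar R) :
  measurable_fun setT f -> measurable_fun setT g ->
  (forall x, 0 <= f x) -> (forall y, 0 <= g y) ->
  \int[sfprod m1 m2]_z (f z.1 * g z.2) = (\int[m1]_x f x) * (\int[m2]_y g y).
Proof.
move=> mf mg f0 g0; rewrite ge0_integral_sfprod1//=; last 2 first.
- by apply: emeasurable_funM; exact: measurableT_comp.
- by move=> z; rewrite mule_ge0.
under eq_integral do rewrite ge0_integralZl//.
by rewrite ge0_integralZr// integral_ge0.
Qed.

(** By uniqueness of the product measure it is enough to compare both sides on rectangles, and the
    preimage of a rectangle is a rectangle. *)
Lemma sfprod_pushforward (f : T1 -> T1) (g : T2 -> T2) :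
  measurable_fun setT f -> measurable_fun setT g ->
  (forall A, measurable A -> m1 (f @^-1` A) = m1 A) ->
  (forall A, measurable A -> m2 (g @^-1` A) = m2 A) ->
  forall A, measurable A ->
  sfprod m1 m2 ((fun z => (f z.1, g z.2)) @^-1` A) = sfprod m1 m2 A.
Proof.
move=> mf mg fm gm A mA.
have mh : measurable_fun setT (fun z : T1 * T2 => (f z.1, g z.2)).
  by apply: measurable_fun_pair; exact: measurableT_comp.
pose h : {mfun (T1 * T2)%type >-> (T1 * T2)%type} :=
  HB.pack (fun z : T1 * T2 => (f z.1, g z.2)) (isMeasurableFun.Build _ _ _ _ _ mh).
apply/esym; apply: (@product_measure_unique _ _ _ _ _ m1 m2
  (pushforward (sfprod m1 m2) h)) => // B C mB mC.
have mfB : measurable (f @^-1` B) by rewrite -[_ @^-1` _]setTI; exact: mf.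
have mgC : measurable (g @^-1` C) by rewrite -[_ @^-1` _]setTI; exact: mg.
change (sfprod m1 m2 ((f @^-1` B) `*` (g @^-1` C)) = m1 B * m2 C).
by rewrite sfprodX// fm// gm.
Qed.

End Sfprod.

(** * Measurability on R^3 and reflection invariance of Lebesgue measure *)

Section MeasurableVec3.
Context {R : realType}.
Notation V3 := (vec3 (measurableTypeR R)).
Local Open Scope ring_scope.

Lemma measurable_coord1 d (T : measurableType d) (a : T -> V3) :
  measurable_fun setT a -> measurable_fun setT (fun x => (a x).1.1 : R).
Proof.
move=> ma; apply: (measurableT_comp (f := fst) (g := fun x => (a x).1)) => //.
exact: (measurableT_comp (f := fst)).
Qed.

Lemma measurable_coord2 d (T : measurableType d) (a : T -> V3) :
  measurable_fun setT a -> measurable_fun setT (fun x => (a x).1.2 : R).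
Proof.
move=> ma; apply: (measurableT_comp (f := snd) (g := fun x => (a x).1)) => //.
exact: (measurableT_comp (f := fst)).
Qed.

Lemma measurable_coord3 d (T : measurableType d) (a : T -> V3) :
  measurable_fun setT a -> measurable_fun setT (fun x => (a x).2 : R).
Proof. by move=> ma; exact: (measurableT_comp (f := snd)). Qed.

Lemma measurable_dot d (T : measurableType d) (a b : T -> V3) :
  measurable_fun setT a -> measurable_fun setT b ->
  measurable_fun setT (fun x => dot (a x) (b x) : R).
Proof.
move=> ma mb; rewrite /dot; apply: measurable_funD.
  apply: measurable_funD.
    by apply: measurable_funM; exact: measurable_coord1.
  by apply: measurable_funM; exact: measurable_coord2.
by apply: measurable_funM; exact: measurable_coord3.
Qed.

Lemma measurable_sqrt : measurable_fun setT (@Num.sqrt R).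
Proof. by apply: continuous_measurable_fun; exact: sqrt_continuous. Qed.

Lemma measurable_enorm d (T : measurableType d) (a : T -> V3) :
  measurable_fun setT a -> measurable_fun setT (fun x => enorm (a x) : R).
Proof.
by move=> ma; apply: (measurableT_comp measurable_sqrt); exact: measurable_dot.
Qed.

Lemma measurable_subvec d (T : measurableType d) (a b : T -> V3) :
  measurable_fun setT a -> measurable_fun setT b ->
  measurable_fun setT (fun x => (a x - b x : vec3 R) : V3).
Proof.
move=> ma mb; apply: measurable_fun_pair; first apply: measurable_fun_pair.
- by apply: measurable_funB; exact: measurable_coord1.
- by apply: measurable_funB; exact: measurable_coord2.
- by apply: measurable_funB; exact: measurable_coord3.
Qed.

(** On nonnegative reals inversion coincides with the real power of exponent -1, which is
    measurable; at 0 both take the value 0. *)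
Lemma measurable_inv_ge0 d (T : measurableType d) (a : T -> R) :
  (forall x, 0 <= a x) ->
  measurable_fun setT a -> measurable_fun setT (fun x => (a x)^-1).
Proof.
move=> a0 ma; under eq_fun do rewrite -powR_inv1//.
by apply: (measurableT_comp (f := fun y : R => y `^ (-1)) (g := a)) => //;
  exact: measurable_powR.
Qed.

(** Reflection preserves the measure on the line, hence on R^3 by two uses of [sfprod_pushforward];
    a change of variables concludes. *)
Lemma lebesgue3N (F : V3 -> \bar R) :
  measurable_fun setT F -> (forall x, 0 <= F x)%E ->
  (\int[lebesgue3]_x F x = \int[lebesgue3]_x F (- (x : vec3 R))%R)%E.
Proof.
move=> mF F0.
have opp_mu A : measurable A ->
    lebesgue_measure ((-%R : measurableTypeR R -> measurableTypeR R) @^-1` A) =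
    @lebesgue_measure R A by exact: lebesgue_measureN.
have mopp : measurable_fun setT (-%R : measurableTypeR R -> measurableTypeR R).
  exact: oppr_measurable.
pose M2 := (measurableTypeR R * measurableTypeR R)%type.
pose N2 (z : M2) : M2 := (- z.1, - z.2).
have mN2 : measurable_fun setT N2.
  apply: measurable_fun_pair.
    by apply: measurable_funN; exact: measurable_fst.
  by apply: measurable_funN; exact: measurable_snd.
pose N (z : V3) : V3 := (N2 z.1, - z.2).
have mN : measurable_fun setT N.
  apply: measurable_fun_pair.
    exact: (measurableT_comp mN2 measurable_fst).
  by apply: measurable_funN; exact: measurable_snd.
have N2E B : measurable B -> sfprod lebesgue_measure lebesgue_measure (N2 @^-1` B) =
    sfprod lebesgue_measure (@lebesgue_measure R) B.
  move=> mB; exact: (sfprod_pushforward _ _ _ _ mopp mopp opp_mu opp_mu B mB).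
have NE A : measurable A -> lebesgue3 (N @^-1` A) = @lebesgue3 R A.
  move=> mA.
  have := sfprod_pushforward (sfprod (@lebesgue_measure R) (@lebesgue_measure R))
    (@lebesgue_measure R) N2 -%R mN2 mopp.
  by move=> /(_ N2E opp_mu A mA).
have F0' : {in [set: V3], forall x, 0 <= F x}%E by move=> x _; exact: F0.
have := @ge0_integral_pushforward _ _ _ _ R N mN lebesgue3 setT F measurableT mF F0'.
rewrite preimage_setT => H; transitivity (\int[pushforward lebesgue3 N]_y F y)%E.
  by apply: eq_measure_integral => A mA _; exact/esym/NE.
rewrite H; apply: eq_integral => x _.
by case: x => [[x1 x2] x3].
Qed.

End MeasurableVec3.

(** * Averaging out the tilt, and lower bounds from cubes *)

Section Integrals.
Context {R : realType}.
Notation V3 := (vec3 (measurableTypeR R)).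
Notation P6 := (phase (measurableTypeR R)).

Lemma dotNl (p q : vec3 R) : dot (- p)%R q = (- dot p q)%R.
Proof. by rewrite /dot/= !mulNr !opprD. Qed.

Lemma dotNr (p q : vec3 R) : dot p (- q)%R = (- dot p q)%R.
Proof. by rewrite /dot/= !mulrN !opprD. Qed.

(* Reflecting p averages the factor L (p . q) to 1. *)
Lemma integral_tilt (L : R -> R) (k w : V3 -> \bar R) :
  measurable_fun setT L -> (forall s, 0 <= L s)%R ->
  (forall s, L s + L (- s) = 2)%R ->
  measurable_fun setT k -> measurable_fun setT w ->
  (forall p, 0 <= k p) -> (forall q, 0 <= w q) ->
  (forall p, k (- (p : vec3 R))%R = k p) ->
  \int[lebesgue6]_x (k x.1 * w x.2 * (L (dot x.1 x.2))%:E) =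
  (\int[lebesgue3]_p k p) * (\int[lebesgue3]_q w q).
Proof.
move=> mL L0 LN mk mw k0 w0 kN.
have mLd : measurable_fun setT (fun x : P6 => (L (dot x.1 x.2))%:E).
  apply/measurable_EFinP.
  apply: (measurableT_comp (f := L) (g := fun x : P6 => dot x.1 x.2)) => //.
  by apply: measurable_dot; [exact: measurable_fst|exact: measurable_snd].
have mLq (q : V3) : measurable_fun setT (fun p : V3 => (L (dot p q))%:E).
  apply/measurable_EFinP.
  apply: (measurableT_comp (f := L) (g := fun p : V3 => dot p q)) => //.
  by apply: measurable_dot; [exact: measurable_id|exact: measurable_cst].
have mLqN (q : V3) : measurable_fun setT (fun p : V3 => (L (- dot p q))%:E).
  apply/measurable_EFinP.
  apply: (measurableT_comp (f := L) (g := fun p : V3 => (- dot p q)%R)) => //.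
  apply: measurable_funN.
  by apply: measurable_dot; [exact: measurable_id|exact: measurable_cst].
rewrite (ge0_integral_sfprod2 lebesgue3 lebesgue3); last 2 first.
- apply: emeasurable_funM => //; apply: emeasurable_funM.
    exact: (measurableT_comp mk measurable_fst).
  exact: (measurableT_comp mw measurable_snd).
- by move=> z; rewrite !mule_ge0// lee_fin.
have J q : \int[lebesgue3]_p (k p * (L (dot p q))%:E) = \int[lebesgue3]_p k p.
  set J := LHS; set K := RHS.
  have JN : J = \int[lebesgue3]_p (k p * (L (- dot p q))%:E).
    rewrite /J lebesgue3N; last 2 first.
    - exact: emeasurable_funM.
    - by move=> p; rewrite mule_ge0// lee_fin.
    by apply: eq_integral => p _; rewrite kN dotNl.
  (* Comparing the doubles and then multiplying by 1/2 needs no subtraction, so infinite integrals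
     are covered too. *)
  have JJ : 2%:E * J = 2%:E * K.
    rewrite -[in RHS]ge0_integralZl//.
    rewrite (_ : 2%:E * J = J + J); last by rewrite -[J in RHS]mul1e -ge0_muleDl.
    rewrite {2}JN -ge0_integralD//.
    - apply: eq_integral => p _.
      by rewrite -ge0_muleDr ?lee_fin// -EFinD LN muleC.
    - by move=> p _; rewrite mule_ge0// lee_fin.
    - exact: emeasurable_funM.
    - by move=> p _; rewrite mule_ge0// lee_fin.
    - exact: emeasurable_funM.
  have := congr1 (mule (2^-1)%:E) JJ.
  by rewrite !muleA -!EFinM mulVf ?mul1e.
rewrite -[RHS]muleC -ge0_integralZr//; last exact: integral_ge0.
apply: eq_integral => q _ /=; rewrite -(J q).
under eq_integral do rewrite (muleC (k _)) -muleA.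
rewrite ge0_integralZl//; first exact: emeasurable_funM.
by move=> p _; rewrite mule_ge0// lee_fin.
Qed.

Lemma le_integral_on d (T : measurableType d) (mu : {measure set T -> \bar R})
    (A : set T) (c : R) (F : T -> \bar R) :
  measurable A -> (0 <= c)%R -> measurable_fun setT F -> (forall x, 0 <= F x) ->
  (forall x, A x -> c%:E <= F x) -> c%:E * mu A <= \int[mu]_x F x.
Proof.
move=> mA c0 mF F0 cF; rewrite -integral_cst//.
apply: (@le_trans _ _ (\int[mu]_(x in A) F x)); last exact: ge0_subset_integral.
by apply: ge0_le_integral => //; exact: measurable_funTS.
Qed.

Definition cube (a : vec3 R) (w : R) : set V3 :=
  (`[a.1.1, (a.1.1 + w)%R]%classic `*` `[a.1.2, (a.1.2 + w)%R]%classic) `*`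
  `[a.2, (a.2 + w)%R]%classic.

Lemma measurable_cube a w : measurable (cube a w).
Proof. by apply: measurableX; [apply: measurableX|]; exact: measurable_itv. Qed.

Lemma lebesgue3_cube a w : (0 <= w)%R -> lebesgue3 (cube a w) = (w ^+ 3)%:E.
Proof.
move=> w0; pose I c := `[c, (c + w)%R]%classic : set (measurableTypeR R).
have E c : @lebesgue_measure R (I c) = w%:E.
  rewrite lebesgue_measure_itv/= lte_fin ltrDl -EFinB addrAC subrr add0r.
  by case: ltgtP w0 => // <-.
have mI c : measurable (I c) by exact: measurable_itv.
have E2 := sfprodX (@lebesgue_measure R) (@lebesgue_measure R) (I a.1.1)
  (I a.1.2) (mI _) (mI _).
have E3 := sfprodX (sfprod (@lebesgue_measure R) (@lebesgue_measure R))
  (@lebesgue_measure R) (I a.1.1 `*` I a.1.2) (I a.2)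
  (measurableX (mI _) (mI _)) (mI _).
apply: (etrans E3); transitivity ((w * w)%:E * w%:E).
  congr (_ * _); last exact: E.
  by apply: (etrans E2); rewrite [RHS]EFinM; congr (_ * _); exact: E.
by rewrite -EFinM -expr2 -exprSr.
Qed.

Lemma le_integral_cube3 (a : vec3 R) (w c : R) (F : V3 -> \bar R) :
  (0 <= w)%R -> (0 <= c)%R -> measurable_fun setT F -> (forall x, 0 <= F x) ->
  (forall p, cube a w p -> c%:E <= F p) ->
  (c * w ^+ 3)%:E <= \int[lebesgue3]_p F p.
Proof.
move=> w0 c0 mF F0 cF; rewrite EFinM -(lebesgue3_cube a)//.
by apply: le_integral_on => //; exact: measurable_cube.
Qed.

(** Every lower bound for an integral over [lebesgue6] below keeps only a product of two cubes on
    which the integrand has a constant lower bound. *)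
Lemma le_integral_cube6 (a a' : vec3 R) (w w' c : R) (F : P6 -> \bar R) :
  (0 <= w)%R -> (0 <= w')%R -> (0 <= c)%R ->
  measurable_fun setT F -> (forall x, 0 <= F x) ->
  (forall p q, cube a w p -> cube a' w' q -> c%:E <= F (p, q)) ->
  (c * (w ^+ 3 * w' ^+ 3))%:E <= \int[lebesgue6]_x F x.
Proof.
move=> w0 w'0 c0 mF F0 cF.
rewrite EFinM EFinM -(lebesgue3_cube a)// -(lebesgue3_cube a')//.
have mB := measurableX (measurable_cube a w) (measurable_cube a' w').
have <- := sfprodX (@lebesgue3 R) (@lebesgue3 R) _ _ (measurable_cube a w)
  (measurable_cube a' w').
apply: le_integral_on => //.
by move=> [p q] [/= Ap Bq]; exact: cF.
Qed.

End Integrals.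

(** * The isotropic Gaussian on R^3 *)

Section Gauss3.
Context {R : realType}.
Notation V3 := (vec3 (measurableTypeR R)).
Local Open Scope ring_scope.

Lemma dot_ge0 (p : vec3 R) : 0 <= dot p p.
Proof. by rewrite /dot -!expr2 !addr_ge0 ?sqr_ge0. Qed.

Lemma enorm_ge0 (p : vec3 R) : 0 <= enorm p. Proof. exact: sqrtr_ge0. Qed.

Lemma sqr_enorm (p : vec3 R) : enorm p ^+ 2 = dot p p.
Proof. by rewrite sqr_sqrtr// dot_ge0. Qed.

Lemma enormN (p : vec3 R) : enorm (- p) = enorm p.
Proof. by rewrite /enorm dotNl dotNr opprK. Qed.

Lemma normal_peakZ (a s : R) : 0 < a -> normal_peak (a * s) = normal_peak s / a.
Proof.
move=> a0; rewrite /normal_peak exprMn -mulrA -mulrnAr sqrtrM ?sqr_ge0//.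
by rewrite sqrtr_sqr gtr0_norm// invfM mulrC.
Qed.

(** Written through [dot], so that smoothness, evenness and rotation invariance can be read off;
    [gauss3E] recovers the product of three normal densities for integration. *)
Definition gauss3 (s : R) (p : vec3 R) : R :=
  normal_peak s ^+ 3 * expR (- dot p p / (s ^+ 2 *+ 2)).

Lemma gauss3_ge0 s p : 0 <= gauss3 s p.
Proof. by rewrite mulr_ge0 ?expR_ge0// exprn_ge0// normal_peak_ge0. Qed.

Lemma gauss3N s p : gauss3 s (- p) = gauss3 s p.
Proof. by rewrite /gauss3 dotNl dotNr opprK. Qed.

Lemma gauss3_ub s p : gauss3 s p <= normal_peak s ^+ 3.
Proof.
rewrite ler_piMr ?exprn_ge0 ?normal_peak_ge0// -expR0 ler_expR.
by rewrite mulNr oppr_le0 divr_ge0 ?dot_ge0// mulrn_wge0 ?sqr_ge0.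
Qed.

(** The bound 12 = 3 * 2^2 fits points whose coordinates are at most 2 s in absolute value; the
    exponent is then at least -6. *)
Lemma gauss3_lb (s : R) p : 0 < s -> dot p p <= 12 * s ^+ 2 ->
  normal_peak 1 ^+ 3 * expR (- 6) / s ^+ 3 <= gauss3 s p.
Proof.
move=> s0 ps; rewrite /gauss3.
have -> : normal_peak s = normal_peak 1 / s by rewrite -normal_peakZ ?mulr1.
rewrite expr_div_n [leLHS]mulrAC ler_pM2l; last first.
  by rewrite divr_gt0 ?exprn_gt0// normal_peak_gt0// oner_eq0.
rewrite ler_expR mulNr lerN2 ler_pdivrMr ?pmulrn_lgt0 ?exprn_gt0//.
by rewrite mulr2n; move: ps; lra.
Qed.

(** The exponential weight halves the quadratic exponent, which multiplies the standard deviation by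
    sqrt 2; the peaks differ by sqrt 2 per coordinate. Weights dominated by this exponential
    therefore have finite Gaussian integrals. *)
Lemma gauss3_spread (s : R) p : 0 < s ->
  gauss3 s p * expR (dot p p / (4 * s ^+ 2)) =
  Num.sqrt 2 ^+ 3 * gauss3 (Num.sqrt 2 * s) p.
Proof.
move=> s0; have s20 : 0 < Num.sqrt (2 : R) by rewrite sqrtr_gt0.
rewrite /gauss3 normal_peakZ// expr_div_n.
have -> : expR (- dot p p / ((Num.sqrt 2 * s) ^+ 2 *+ 2)) =
    expR (- dot p p / (s ^+ 2 *+ 2)) * expR (dot p p / (4 * s ^+ 2)).
  by rewrite -expRD exprMn sqr_sqrtr//; congr expR; field; rewrite gt_eqF.
by field; rewrite gt_eqF.
Qed.

Lemma gauss3E (s : R) p : s != 0 -> gauss3 s p =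
  normal_pdf 0 s p.1.1 * normal_pdf 0 s p.1.2 * normal_pdf 0 s p.2.
Proof.
move=> s0; rewrite !normal_pdfE//= /normal_fun /gauss3 !subr0.
rewrite [RHS](_ : _ = normal_peak s ^+ 3 * (expR (- p.1.1 ^+ 2 / (s ^+ 2 *+ 2)) *
  expR (- p.1.2 ^+ 2 / (s ^+ 2 *+ 2)) * expR (- p.2 ^+ 2 / (s ^+ 2 *+ 2)))); last by ring.
by rewrite -!expRD -!mulrDl -!opprD /dot -!expr2.
Qed.

Lemma measurable_gauss3 s : measurable_fun setT (gauss3 s : V3 -> R).
Proof.
apply: measurable_funM; first exact: measurable_cst.
apply: (measurableT_comp (f := expR)) => //.
apply: measurable_funM; last exact: measurable_cst.
by apply: measurable_funN; exact: measurable_dot.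
Qed.

Lemma integral_gauss3 (s : R) : s != 0 ->
  (\int[lebesgue3]_p (gauss3 s (p : V3))%:E = 1)%E.
Proof.
move=> s0.
have mN : measurable_fun setT (fun x : measurableTypeR R => (normal_pdf 0 s x)%:E).
  by apply/measurable_EFinP; exact: measurable_normal_pdf.
have N0 x : (0 <= (normal_pdf 0 s x)%:E)%E by rewrite lee_fin normal_pdf_ge0.
under eq_integral do rewrite gauss3E// EFinM EFinM.
rewrite (ge0_integral_sfprodM (sfprod lebesgue_measure lebesgue_measure)
  lebesgue_measure (fun z => (normal_pdf 0 s z.1)%:E * (normal_pdf 0 s z.2)%:E)%E
  (fun x => (normal_pdf 0 s x)%:E))//; last 2 first.
- apply: emeasurable_funM.
    exact: (measurableT_comp mN measurable_fst).
  exact: (measurableT_comp mN measurable_snd).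
- by move=> z; rewrite mule_ge0.
rewrite (ge0_integral_sfprodM lebesgue_measure lebesgue_measure
  (fun x => (normal_pdf 0 s x)%:E) (fun x => (normal_pdf 0 s x)%:E))//.
by rewrite integral_normal_pdf !mule1.
Qed.

End Gauss3.

(** * The tilt factor *)

Section Tilt.
Context {R : realType}.
Local Open Scope ring_scope.

(** This is 1 - tanh(s / 2), the factor L of the overview. *)
Definition tilt (s : R) : R := 2 / (1 + expR s).

Lemma expRD1_gt0 (s : R) : 0 < 1 + expR s.
Proof. by rewrite addr_gt0// expR_gt0. Qed.

Lemma tilt_ge0 s : 0 <= tilt s.
Proof. by rewrite divr_ge0// ltW// expRD1_gt0. Qed.

Lemma tiltDN s : tilt s + tilt (- s) = 2.
Proof.
rewrite /tilt expRN; field.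
by rewrite !gt_eqF ?expR_gt0 ?expRD1_gt0// addrC expRD1_gt0.
Qed.

Lemma tilt_ge1 s : s <= 0 -> 1 <= tilt s.
Proof.
move=> s0; rewrite /tilt ler_pdivlMr ?expRD1_gt0// mul1r.
have : expR s <= 1 by rewrite -expR0 ler_expR.
lra.
Qed.

(** For s > 0 the claim reduces to s <= 1 + e^s. It caps the positive part of the virial however
    large the momenta are. *)
Lemma mul_tilt_le2 s : s * tilt s <= 2.
Proof.
have [s0|s0] := leP s 0.
  by rewrite (@le_trans _ _ 0)// mulr_le0_ge0// tilt_ge0.
rewrite /tilt mulrA ler_pdivrMr ?expRD1_gt0//.
have := expR_ge1Dx s; lra.
Qed.

Lemma measurable_tilt : measurable_fun setT tilt.
Proof.
apply: measurable_funM; first exact: measurable_cst.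
apply: (measurable_inv_ge0 _ _ (fun s => 1 + expR s)) => [s|].
  exact/ltW/expRD1_gt0.
by apply: measurable_funD => //; exact: measurable_cst.
Qed.

End Tilt.

(** * The tilted product density and its energy *)

Section TiltedProduct.
Context {R : realType}.
Notation V3 := (vec3 (measurableTypeR R)).
Notation P6 := (phase (measurableTypeR R)).
Local Open Scope ring_scope.

(** Of the radial symmetry only evenness is kept: averaging the tilt takes just the reflection of
    p. *)
Definition even_density (h : V3 -> R) :=
  [/\ measurable_fun setT h, forall p, 0 <= h p, forall p, h (- (p : vec3 R)) = h p
    & (\int[lebesgue3]_p (h p)%:E = 1)%E].

Variables h rho : V3 -> R.
Hypothesis hD : even_density h.
Hypothesis rhoD : even_density rho.

Let mh : measurable_fun setT h. Proof. by case: hD. Qed.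
Let h0 p : 0 <= h p. Proof. by case: hD. Qed.
Let hN p : h (- (p : vec3 R)) = h p. Proof. by case: hD. Qed.
Let int_h : (\int[lebesgue3]_p (h p)%:E = 1)%E. Proof. by case: hD. Qed.
Let mrho : measurable_fun setT rho. Proof. by case: rhoD. Qed.
Let rho0 p : 0 <= rho p. Proof. by case: rhoD. Qed.
Let int_rho : (\int[lebesgue3]_p (rho p)%:E = 1)%E. Proof. by case: rhoD. Qed.

Definition tilted (x : P6) : R := h x.1 * rho x.2 * tilt (dot x.1 x.2).

Lemma tilted_ge0 x : 0 <= tilted x.
Proof. by rewrite !mulr_ge0// tilt_ge0. Qed.

Lemma measurable_tilted : measurable_fun setT tilted.
Proof.
apply: measurable_funM.
  apply: measurable_funM.
    exact: (measurableT_comp mh measurable_fst).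
  exact: (measurableT_comp mrho measurable_snd).
apply: (measurableT_comp measurable_tilt).
by apply: measurable_dot; [exact: measurable_fst|exact: measurable_snd].
Qed.

(** An even momentum weight keeps [a p * h p] even, so [integral_tilt] applies. The weight [b] takes
    extended values because the potential generated by [rho] will be one. *)
Lemma integral_tilted (a : V3 -> R) (b : V3 -> \bar R) :
  measurable_fun setT a -> (forall p, 0 <= a p) ->
  (forall p, a (- (p : vec3 R)) = a p) ->
  measurable_fun setT b -> (forall q, 0 <= b q)%E ->
  (\int[lebesgue6]_x ((a x.1)%:E * b x.2 * (tilted x)%:E) =
   (\int[lebesgue3]_p (a p * h p)%:E) * (\int[lebesgue3]_q (b q * (rho q)%:E)))%E.
Proof.
move=> ma a0 aN mb b0.
rewrite -(integral_tilt tilt (fun p => (a p * h p)%:E) (fun q => (b q * (rho q)%:E))%E).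
- apply: eq_integral => x _; rewrite /tilted !EFinM.
  by rewrite -!muleA; congr (_ * _)%E; rewrite [LHS]muleCA.
- exact: measurable_tilt.
- exact: tilt_ge0.
- exact: tiltDN.
- by apply/measurable_EFinP; exact: measurable_funM.
- by apply: emeasurable_funM => //; exact/measurable_EFinP.
- by move=> p; rewrite lee_fin mulr_ge0.
- by move=> q; rewrite mule_ge0// lee_fin.
- by move=> p; rewrite aN hN.
Qed.

Lemma integral_tilted_eq1 : (\int[lebesgue6]_x (tilted x)%:E = 1)%E.
Proof.
transitivity (\int[lebesgue6]_(x in [set: P6]) (1%:E * 1%:E * (tilted x)%:E))%E.
  by apply: eq_integral => x _; rewrite !mul1e.
rewrite (integral_tilted (fun=> 1) (fun=> 1%:E))//.
- under eq_integral do rewrite mul1r.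
  under [X in (_ * X)%E]eq_integral do rewrite mul1e.
  by rewrite int_h int_rho mule1.
Qed.

Definition kinetic : \bar R :=
  (\int[lebesgue3]_p (Num.sqrt (1 + enorm p ^+ 2) * h p)%:E)%E.

(** Here [lebesgue6] measures pairs of positions: both components of [z] are positions. *)
Definition interaction : \bar R :=
  (\int[lebesgue6]_z (rho z.1 * rho z.2 / enorm (z.2 - z.1))%:E)%E.

Lemma measurable_sqrt1enorm :
  measurable_fun setT (fun p : V3 => Num.sqrt (1 + enorm p ^+ 2) : R).
Proof.
apply: (measurableT_comp measurable_sqrt).
apply: measurable_funD; first exact: measurable_cst.
by apply: measurable_funX; exact: measurable_enorm.
Qed.

(** The kinetic weight is even in p and the Coulomb kernel does not involve momenta, so the tilt
    averages out of the kinetic integral and of both integrals in the potential term. *)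
Lemma energy_tilted : energy tilted = (kinetic - (2^-1)%:E * interaction)%E.
Proof.
have mi (q' : V3) : measurable_fun setT (fun q : V3 => (enorm (q - q' : vec3 R))^-1 : R).
  apply: measurable_inv_ge0 => [q|]; first exact: enorm_ge0.
  apply: measurable_enorm; apply: measurable_subvec; first exact: measurable_id.
  exact: measurable_cst.
pose G (z : P6) : \bar R := (rho z.2 / enorm (z.2 - z.1 : vec3 R))%:E.
have mG : measurable_fun setT G.
  apply/measurable_EFinP; apply: measurable_funM.
    exact: (measurableT_comp mrho measurable_snd).
  apply: measurable_inv_ge0 => [q|]; first exact: enorm_ge0.
  by apply: measurable_enorm; apply: measurable_subvec;
    [exact: measurable_snd|exact: measurable_fst].
have G0 z : (0 <= G z)%E by rewrite lee_fin divr_ge0// enorm_ge0.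
pose Phi (q' : V3) : \bar R := (\int[lebesgue3]_q G (q', q))%E.
have mPhi : measurable_fun setT Phi.
  exact: (@measurable_fun_fubini_tonelli_F _ _ _ _ _ lebesgue3 G mG G0).
have Phi0 q' : (0 <= Phi q')%E by exact: integral_ge0.
rewrite /energy; congr (_ - _ * _)%E.
  transitivity (\int[lebesgue6]_(x in [set: P6])
      ((Num.sqrt (1 + enorm x.1 ^+ 2))%:E * 1%:E * (tilted x)%:E))%E.
    by apply: eq_integral => x _; rewrite mule1 EFinM.
  rewrite (integral_tilted (fun p => Num.sqrt (1 + enorm p ^+ 2)) (fun=> 1%:E))//.
  - under [X in (_ * X)%E]eq_integral do rewrite mul1e.
    by rewrite int_rho mule1.
  - exact: measurable_sqrt1enorm.
  - by move=> p; rewrite enormN.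
(* For fixed x' the inner integral is f(x') times [Phi], the potential of [rho] at the position of
   x'; the outer integral then pairs [Phi] with [rho]. *)
transitivity (\int[lebesgue6]_(x' in [set: P6]) (1%:E * Phi x'.2 * (tilted x')%:E))%E.
  apply: eq_integral => x' _.
  transitivity (\int[lebesgue6]_(x in [set: P6])
     ((tilted x')%:E * (1%:E * ((enorm (x.2 - x'.2 : vec3 R))^-1)%:E * (tilted x)%:E)))%E.
    apply: eq_integral => x _; rewrite mul1e -!EFinM; congr (_%:E).
    by rewrite -[LHS]mulrA; congr (_ * _)%R; exact: mulrC.
  rewrite ge0_integralZl//; last 3 first.
  - apply: emeasurable_funM; last first.
      by apply/measurable_EFinP; exact: measurable_tilted.
    apply: emeasurable_funM; first exact: measurable_cst.
    by apply/measurable_EFinP; exact: (measurableT_comp (mi x'.2) measurable_snd).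
  - by move=> x _; rewrite mul1e mule_ge0// lee_fin ?invr_ge0 ?enorm_ge0 ?tilted_ge0.
  - by rewrite lee_fin tilted_ge0.
  rewrite (integral_tilted (fun=> 1) (fun q => ((enorm (q - x'.2 : vec3 R))^-1)%:E))//.
  - under eq_integral do rewrite mul1r.
    rewrite int_h !mul1e muleC; congr (_ * _)%E.
    by apply: eq_integral => q _; rewrite -EFinM mulrC.
  - exact/measurable_EFinP.
  - by move=> q; rewrite lee_fin invr_ge0 enorm_ge0.
rewrite (integral_tilted (fun=> 1) Phi)//.
under eq_integral do rewrite mul1r.
rewrite int_h mul1e /interaction.
rewrite (ge0_integral_sfprod1 lebesgue3 lebesgue3
  (fun z : P6 => (rho z.1 * rho z.2 / enorm (z.2 - z.1 : vec3 R))%:E)); last 2 first.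
- rewrite [X in measurable_fun _ X](_ : _ = fun z => ((rho z.1)%:E * G z)%E).
    apply: emeasurable_funM => //; apply/measurable_EFinP.
    exact: (measurableT_comp mrho measurable_fst).
  by apply/funext => z; rewrite -EFinM mulrA.
- by move=> z; rewrite lee_fin divr_ge0 ?enorm_ge0// mulr_ge0.
apply: eq_integral => q' _ /=; rewrite muleC -ge0_integralZl//.
- by apply: eq_integral => q _; rewrite -EFinM mulrA.
- exact: (measurable_fun_pair2 q' mG).
- by rewrite lee_fin.
Qed.

End TiltedProduct.

(** * Moments, virial and interaction of a tilted density *)

Section Estimates.
Context {R : realType}.
Notation V3 := (vec3 (measurableTypeR R)).
Notation P6 := (phase (measurableTypeR R)).
Local Open Scope ring_scope.

Variables h rho : V3 -> R.
Hypothesis hD : even_density h.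
Hypothesis rhoD : even_density rho.

Let mh : measurable_fun setT h. Proof. by case: hD. Qed.
Let h0 p : 0 <= h p. Proof. by case: hD. Qed.
Let hN p : h (- (p : vec3 R)) = h p. Proof. by case: hD. Qed.
Let int_h : (\int[lebesgue3]_p (h p)%:E = 1)%E. Proof. by case: hD. Qed.
Let mrho : measurable_fun setT rho. Proof. by case: rhoD. Qed.
Let rho0 p : 0 <= rho p. Proof. by case: rhoD. Qed.
Let int_rho : (\int[lebesgue3]_p (rho p)%:E = 1)%E. Proof. by case: rhoD. Qed.
Let f0 x : 0 <= tilted h rho x. Proof. exact: tilted_ge0. Qed.
Let mf : measurable_fun setT (tilted h rho). Proof. exact: measurable_tilted. Qed.

Definition cubic_moment (g : V3 -> R) : \bar R :=
  (\int[lebesgue3]_p ((1 + enorm p) ^+ 3 * g p)%:E)%E.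

Lemma measurable_cube1enorm : measurable_fun setT (fun p : V3 => (1 + enorm p) ^+ 3 : R).
Proof.
apply: measurable_funX; apply: measurable_funD; first exact: measurable_cst.
exact: measurable_enorm.
Qed.

Lemma cubic_moment_ge0 g : (forall p, 0 <= g p) -> (0 <= cubic_moment g)%E.
Proof.
by move=> g0; apply: integral_ge0 => p _; rewrite lee_fin mulr_ge0// exprn_ge0//
  addr_ge0// enorm_ge0.
Qed.

(** One has |p| + |q| <= (1 + |p|)(1 + |q|), and the right side is at least 1, so its cube dominates
    all lower powers and splits into two one-variable moments. *)
Lemma moment_tilted k : (k <= 3)%N ->
  (cubic_moment h < +oo)%E -> (cubic_moment rho < +oo)%E ->
  (\int[lebesgue6]_x ((enorm x.1 + enorm x.2) ^+ k * tilted h rho x)%:E < +oo)%E.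
Proof.
move=> k3 Mh Mrho.
have e0 (p : V3) : 0 <= 1 + enorm p by rewrite addr_ge0// enorm_ge0.
pose F (x : P6) := (((1 + enorm x.1) ^+ 3)%:E * ((1 + enorm x.2) ^+ 3)%:E *
  (tilted h rho x)%:E)%E.
apply: (@le_lt_trans _ _ (\int[lebesgue6]_x F x)%E); last first.
  rewrite (integral_tilted _ _ hD rhoD (fun p => (1 + enorm p) ^+ 3)
    (fun p => ((1 + enorm p) ^+ 3)%:E))//.
  - apply: lte_mul_pinfty => //; first exact: cubic_moment_ge0.
    by rewrite ge0_fin_numE//; exact: cubic_moment_ge0.
  - exact: measurable_cube1enorm.
  - by move=> p; rewrite exprn_ge0.
  - by move=> p; rewrite enormN.
  - by apply/measurable_EFinP; exact: measurable_cube1enorm.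
  - by move=> p; rewrite lee_fin exprn_ge0.
apply: ge0_le_integral => //.
- by move=> x _; rewrite lee_fin mulr_ge0// exprn_ge0// addr_ge0// enorm_ge0.
- apply/measurable_EFinP; apply: measurable_funM => //.
  apply: measurable_funX; apply: measurable_funD.
    by apply: measurable_enorm; exact: measurable_fst.
  by apply: measurable_enorm; exact: measurable_snd.
- apply: emeasurable_funM; last exact/measurable_EFinP.
  apply: emeasurable_funM; apply/measurable_EFinP.
    exact: (measurableT_comp measurable_cube1enorm measurable_fst).
  exact: (measurableT_comp measurable_cube1enorm measurable_snd).
- move=> x _; rewrite /F -!EFinM lee_fin ler_wpM2r//.
  have u0 := enorm_ge0 x.1; have v0 := enorm_ge0 x.2.
  set u := enorm x.1 in u0 *; set v := enorm x.2 in v0 *.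
  rewrite -exprMn; apply: (@le_trans _ _ (((1 + u) * (1 + v)) ^+ k)).
    by rewrite lerXn2r ?nnegrE ?mulr_ge0 ?addr_ge0//; nra.
  by rewrite ler_weXn2l//; nra.
Qed.

(** The positive part of the integrand is at most 2 h rho, of integral 2. The negative part is
    bounded below on the two cubes, where p . q <= 0 and the tilt is at least 1. *)
Lemma virial_tilted_le (a a' : vec3 R) (w w' c : R) :
  0 <= w -> 0 <= w' -> 0 <= c ->
  (forall p q, cube a w p -> cube a' w' q ->
    dot p q <= 0 /\ c <= - dot p q * (h p * rho q)) ->
  (virial (tilted h rho) <= (2 - c * (w ^+ 3 * w' ^+ 3))%:E)%E.
Proof.
move=> w0 w'0 c0 cle.
pose F (x : P6) : \bar R := (dot x.2 x.1 * tilted h rho x)%:E.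
have dotC (p q : vec3 R) : dot p q = dot q p by rewrite /dot; ring.
have mF : measurable_fun setT F.
  apply/measurable_EFinP; apply: measurable_funM => //.
  by apply: measurable_dot; [exact: measurable_snd|exact: measurable_fst].
have Fp : (\int[lebesgue6]_x F^\+ x <= 2%:E)%E.
  (* The constant 1 also satisfies L(s) + L(-s) = 2, so [integral_tilt] evaluates this untilted
     product as well. *)
  pose G (x : P6) := ((2 * h x.1)%:E * (rho x.2)%:E * ((fun=> 1) (dot x.1 x.2) : R)%:E)%E.
  have <- : (\int[lebesgue6]_x G x = 2%:E)%E.
    rewrite (integral_tilt (fun=> 1) (fun p => (2 * h p)%:E) (fun q => (rho q)%:E))//.
    - under eq_integral do rewrite EFinM.
      rewrite ge0_integralZl//; first by rewrite int_h int_rho !mule1.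
      + by apply/measurable_EFinP.
      + by move=> p _; rewrite lee_fin.
    - by apply/measurable_EFinP; apply: measurable_funM => //; exact: measurable_cst.
    - exact/measurable_EFinP.
    - by move=> p; rewrite lee_fin mulr_ge0.
    - by move=> p; rewrite hN.
  apply: ge0_le_integral => //.
  - exact: measurable_funepos.
  - apply/measurable_EFinP; apply: measurable_funM; last exact: measurable_cst.
    apply: measurable_funM; last exact: (measurableT_comp mrho measurable_snd).
    apply: measurable_funM; first exact: measurable_cst.
    exact: (measurableT_comp mh measurable_fst).
  - move=> x _; rewrite funeposE /G /F ge_max !lee_fin mulr1 !mulr_ge0// andbT.
    rewrite dotC /tilted -subr_ge0.
    rewrite (_ : _ - _ = h x.1 * rho x.2 *
      (2 - dot x.1 x.2 * tilt (dot x.1 x.2))); last by ring.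
    by rewrite !mulr_ge0// subr_ge0 mul_tilt_le2.
have Fn : ((c * (w ^+ 3 * w' ^+ 3))%:E <= \int[lebesgue6]_x F^\- x)%E.
  apply: (le_integral_cube6 a a') => //; first exact: measurable_funeneg.
  move=> p q Ap Aq; have [d0 cd] := cle p q Ap Aq.
  rewrite funenegE le_max; apply/orP; left.
  rewrite /F -EFinN lee_fin; apply: (le_trans cd).
  rewrite /= dotC /tilted /= -mulNr ler_wpM2l ?oppr_ge0//; first by rewrite dotC.
  by rewrite ler_peMr ?mulr_ge0// tilt_ge1.
rewrite /virial (integralE _ _ F) EFinB.
exact: leeB.
Qed.

Lemma measurable_interaction : measurable_fun setT
  (fun z : P6 => (rho z.1 * rho z.2 / enorm (z.2 - z.1 : vec3 R))%:E).
Proof.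
apply/measurable_EFinP; apply: measurable_funM.
  apply: measurable_funM.
    exact: (measurableT_comp mrho measurable_fst).
  exact: (measurableT_comp mrho measurable_snd).
apply: measurable_inv_ge0 => [q|]; first exact: enorm_ge0.
by apply: measurable_enorm; apply: measurable_subvec;
  [exact: measurable_snd|exact: measurable_fst].
Qed.

Lemma interaction_ge (a a' : vec3 R) (w c : R) : 0 <= w -> 0 <= c ->
  (forall q q', cube a w q -> cube a' w q' ->
    c <= rho q * rho q' / enorm (q' - q : vec3 R)) ->
  ((c * (w ^+ 3 * w ^+ 3))%:E <= interaction rho)%E.
Proof.
move=> w0 c0 cle; apply: (le_integral_cube6 a a') => //.
- exact: measurable_interaction.
- by move=> z; rewrite lee_fin divr_ge0 ?enorm_ge0 ?mulr_ge0.
Qed.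

End Estimates.

(** The power 2/3 is increasing and fixes 1, so it suffices that the integral of f^(3/2) over the
    two cubes is at least 1. *)
Lemma Lnorm32_ge1 {R : realType} (a a' : vec3 R) (w w' M : R)
    (f : phase (measurableTypeR R) -> R) :
  (0 <= w)%R -> (0 <= w')%R -> (0 <= M)%R ->
  measurable_fun setT f -> (forall x, 0 <= f x)%R ->
  (forall p q, cube a w p -> cube a' w' q -> M <= f (p, q))%R ->
  (1 <= M `^ (3 / 2) * (w ^+ 3 * w' ^+ 3))%R ->
  1 <= 'N[lebesgue6]_(3 / 2)%:E [EFin \o f].
Proof.
move=> w0 w'0 M0 mf f0 Mf M1; rewrite unlock.
rewrite -(poweR1r (3 / 2 : R)^-1); apply: gt0_ler_poweR.
- by rewrite invr_ge0.
- by rewrite in_itv/= leey lee01.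
- by rewrite in_itv/= leey andbT integral_ge0// => x _; exact: poweR_ge0.
apply: (@le_trans _ _ (M `^ (3 / 2) * (w ^+ 3 * w' ^+ 3))%:E).
  by rewrite lee_fin.
rewrite (eq_integral (fun x => (f x `^ (3 / 2))%R%:E)); last first.
  by move=> x _ /=; rewrite ger0_norm.
apply: (le_integral_cube6 a a') => //.
- exact: powR_ge0.
- apply/measurable_EFinP.
  apply: (measurableT_comp (f := fun y : R => (y `^ (3 / 2))%R) (g := f)).
    exact: measurable_powR.
  exact: mf.
- by move=> x; rewrite lee_fin powR_ge0.
- by move=> p q Ap Aq; rewrite lee_fin ge0_ler_powR ?nnegrE//; exact: Mf.
Qed.

(** * Finiteness of the interaction for bounded densities *)

Section InteractionFinite.
Context {R : realType}.
Notation V3 := (vec3 (measurableTypeR R)).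
Notation P6 := (phase (measurableTypeR R)).
Local Open Scope ring_scope.

Lemma dyadic_bracket (y : R) : y <= 1 \/ exists m : nat, 2 ^+ m < y <= 2 ^+ m.+1.
Proof.
have ex : exists n, y <= 2 ^+ n.
  by exists (Num.bound y); apply/ltW; exact: upper_nthrootP.
case: (ex_minnP ex) => -[|m] ym mmin; first by left.
right; exists m; rewrite ym andbT ltNge; apply/negP => /mmin.
by rewrite ltnn.
Qed.

Lemma coord_le_enorm (x : vec3 R) :
  [/\ `|x.1.1| <= enorm x, `|x.1.2| <= enorm x & `|x.2| <= enorm x].
Proof.
have H (c : R) : c ^+ 2 <= dot x x -> `|c| <= enorm x.
  by move=> cx; rewrite -sqrtr_sqr ler_wsqrtr.
have h1 := sqr_ge0 x.1.1; have h2 := sqr_ge0 x.1.2; have h3 := sqr_ge0 x.2.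
by split; apply: H; rewrite /dot; nra.
Qed.

(* 1 / |q - q'| is at most 1 plus the sum of 2 ^ (n + 1) over the n such that
   |q - q'| <= 2 ^ (- n), and such q fill a cube of volume 8 * 8 ^ (- n). *)
Lemma integral_inv_dist_le (rho : V3 -> R) (M : R) (q' : vec3 R) :
  even_density rho -> (forall q, rho q <= M) ->
  (\int[lebesgue3]_q (rho q / enorm ((q : vec3 R) - q'))%:E <= (1 + 32 * M)%:E)%E.
Proof.
move=> [mrho rho0 _ int_rho] rhoM.
have M0 : 0 <= M by exact: le_trans (rho0 0) (rhoM 0).
pose r n : R := 2^-1 ^+ n.
have r0 n : 0 <= r n by rewrite exprn_ge0.
pose C n : set V3 := cube ((q'.1.1 - r n, q'.1.2 - r n), q'.2 - r n) (2 * r n).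
have mC n : measurable (C n) by exact: measurable_cube.
pose u n (q : V3) : \bar R := (M * 2 ^+ n.+1 * \1_(C n) q)%:E.
have c0 n : 0 <= M * 2 ^+ n.+1 by rewrite mulr_ge0// exprn_ge0.
have u0 n q : (0 <= u n q)%E by rewrite lee_fin mulr_ge0.
have mu n : measurable_fun setT (u n).
  apply/measurable_EFinP; apply: measurable_funM; first exact: measurable_cst.
  exact: measurable_indic.
have mrhoE : measurable_fun setT (fun q => (rho q)%:E) by exact/measurable_EFinP.
have mS : measurable_fun setT (fun q => \sum_(0 <= n <oo) u n q)%E.
  by apply: ge0_emeasurable_sum.
have S0 q : (0 <= \sum_(0 <= n <oo) u n q)%E by exact: nneseries_ge0.
apply: (@le_trans _ _ (\int[lebesgue3]_q ((rho q)%:E + \sum_(0 <= n <oo) u n q))%E).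
  apply: ge0_le_integral => //.
  - by move=> q _; rewrite lee_fin divr_ge0// enorm_ge0.
  - apply/measurable_EFinP; apply: measurable_funM => //.
    apply: measurable_inv_ge0 => [q|]; first exact: enorm_ge0.
    apply: measurable_enorm; apply: measurable_subvec; first exact: measurable_id.
    exact: measurable_cst.
  - exact: emeasurable_funD.
  - move=> q _; set x : vec3 R := (q : vec3 R) - q'.
    (* Either 1 / |x| <= 1 and [rho q] suffices, which includes x = 0 with inverse 0, or the single
       summand of index [m] already dominates. *)
    have [y1|[m /andP[my ym]]] := dyadic_bracket (enorm x)^-1.
      apply: (@le_trans _ _ (rho q)%:E); last by rewrite leeDl.
      by rewrite lee_fin -[leRHS]mulr1 ler_wpM2l.
    apply: (@le_trans _ _ (u m q)); last first.
      rewrite (@nneseriesD1 R (fun k => u k q) m xpredT)//.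
      by rewrite addeCA leeDl// adde_ge0 ?lee_fin// nneseries_ge0.
    have xm : enorm x <= r m.
      have [e0|e0] := eqVneq (enorm x) 0; first by rewrite e0.
      have e1 : 0 < enorm x by rewrite lt_def e0 enorm_ge0.
      rewrite /r exprVn -[leLHS]invrK lef_pV2 ?posrE ?invr_gt0 ?exprn_gt0//.
      exact: ltW.
    have qC : C m q.
      have [] := coord_le_enorm x; rewrite /x/=.
      move=> /le_trans/(_ xm); rewrite ler_norml => /andP[a1 b1].
      move=> /le_trans/(_ xm); rewrite ler_norml => /andP[a2 b2].
      move=> /le_trans/(_ xm); rewrite ler_norml => /andP[a3 b3].
      by split; [split|]; rewrite /= in_itv/=; apply/andP; split; lra.
    rewrite /u indicE mem_set// mulr1 lee_fin ler_pM// invr_ge0.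
    exact: enorm_ge0.
rewrite ge0_integralD//; last by move=> q _; rewrite lee_fin.
rewrite [X in (X + _)%E](_ : _ = 1%E); last exact: int_rho.
rewrite integral_nneseries// EFinD leeD2l//.
have int_u n : (\int[lebesgue3]_q u n q)%E = (M * 2 ^+ n.+1 * (2 * r n) ^+ 3)%:E.
  rewrite /u; under eq_integral do rewrite EFinM.
  rewrite ge0_integralZl//; last 2 first.
  - by apply/measurable_EFinP; exact: measurable_indic.
  - by rewrite lee_fin.
  rewrite integral_indic// setIT.
  rewrite [X in (_ * X)%E](_ : _ = ((2 * r n) ^+ 3)%:E); first by rewrite -EFinM.
  by apply: lebesgue3_cube; rewrite mulr_ge0.
(* The integral of [u n] is 16 M / 4^n, compared here with 16 M / 2^n, whose sum is 32 M. *)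
have -> : (32 * M)%:E = (\sum_(0 <= n <oo) (32 * M / (2 ^ (n + 1))%:R)%:E)%E.
  apply/esym/cvg_lim => //.
  by have := @cvg_geometric_eseries_half R (32 * M) 0; rewrite expr0 divr1.
apply: lee_nneseries => [n _ _|n _]; first exact: integral_ge0.
rewrite int_u lee_fin natrX addn1 /r exprVn.
have p2 : 1 <= 2 ^+ n :> R by rewrite exprn_ege1// ler1n.
rewrite [2 ^+ n.+1]exprS; move: p2; set z := 2 ^+ n => z1.
have z0 : 0 < z by exact: lt_le_trans z1.
rewrite [leLHS](_ : _ = 16 * M / z * z^-1); last by field; rewrite gt_eqF.
rewrite [leRHS](_ : _ = 16 * M / z); last by field; rewrite gt_eqF.
by rewrite ler_piMr ?invf_le1// divr_ge0 ?mulr_ge0// ltW.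
Qed.

(** The potential of a bounded density is bounded uniformly in q', and [rho] has mass 1. Finiteness
    is what allows a finite kinetic energy to balance the potential. *)
Lemma interaction_lty (rho : V3 -> R) (M : R) :
  even_density rho -> (forall q, rho q <= M) -> (interaction rho < +oo)%E.
Proof.
move=> rhoD rhoM; have [mrho rho0 _ int_rho] := rhoD.
have M0 : 0 <= M by exact: le_trans (rho0 0) (rhoM 0).
have mI := measurable_interaction _ rhoD.
have mrhoE : measurable_fun setT (fun q => (rho q)%:E) by exact/measurable_EFinP.
have I0 (z : P6) : (0 <= (rho z.1 * rho z.2 / enorm (z.2 - z.1 : vec3 R))%:E)%E.
  by rewrite lee_fin divr_ge0 ?enorm_ge0 ?mulr_ge0.
rewrite /interaction (ge0_integral_sfprod1 lebesgue3 lebesgue3 _ mI I0).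
apply: (@le_lt_trans _ _ (\int[lebesgue3]_q' ((1 + 32 * M)%:E * (rho q')%:E))%E).
  apply: ge0_le_integral => //.
  - by move=> q' _; apply: integral_ge0.
  - exact: (@measurable_fun_fubini_tonelli_F _ _ _ _ _ lebesgue3 _ mI I0).
  - by apply: emeasurable_funM => //; exact: measurable_cst.
  - move=> q' _; rewrite muleC.
    rewrite (eq_integral (fun q : V3 =>
      (rho q')%:E * (rho q / enorm ((q : vec3 R) - q'))%:E)%E); last first.
      by move=> q _; rewrite -EFinM mulrA.
    rewrite ge0_integralZl//.
    + by rewrite lee_wpmul2l ?lee_fin// integral_inv_dist_le.
    + apply/measurable_EFinP; apply: measurable_funM => //.
      apply: measurable_inv_ge0 => [q|]; first exact: enorm_ge0.
      apply: measurable_enorm; apply: measurable_subvec; first exact: measurable_id.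
      exact: measurable_cst.
    + by move=> q _; rewrite lee_fin divr_ge0// enorm_ge0.
    + by rewrite lee_fin.
rewrite ge0_integralZl//; first by rewrite int_rho mule1 ltry.
- by move=> q _; rewrite lee_fin.
- by rewrite lee_fin addr_ge0// mulr_ge0.
Qed.

End InteractionFinite.

(** * Convex mixtures of densities *)

Section Mixture.
Context {R : realType}.
Notation V3 := (vec3 (measurableTypeR R)).
Local Open Scope ring_scope.

Definition mix (t : R) (g1 g2 : V3 -> R) (p : V3) : R := (1 - t) * g1 p + t * g2 p.

Variables (t : R) (g1 g2 : V3 -> R).
Hypotheses (t0 : 0 <= t) (t1 : t <= 1).
Hypotheses (g1D : even_density g1) (g2D : even_density g2).

Lemma integral_mix (a : V3 -> R) : measurable_fun setT a -> (forall p, 0 <= a p) ->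
  (\int[lebesgue3]_p (a p * mix t g1 g2 p)%:E =
   (1 - t)%:E * (\int[lebesgue3]_p (a p * g1 p)%:E) +
   t%:E * (\int[lebesgue3]_p (a p * g2 p)%:E))%E.
Proof.
have [m1 p1 _ _] := g1D; have [m2 p2 _ _] := g2D.
move=> ma a0.
have t'0 : 0 <= 1 - t by rewrite subr_ge0.
have M1 : measurable_fun setT (fun p => (a p * g1 p)%:E).
  by apply/measurable_EFinP; exact: measurable_funM.
have M2 : measurable_fun setT (fun p => (a p * g2 p)%:E).
  by apply/measurable_EFinP; exact: measurable_funM.
have N1 p : (0 <= (a p * g1 p)%:E)%E by rewrite lee_fin mulr_ge0.
have N2 p : (0 <= (a p * g2 p)%:E)%E by rewrite lee_fin mulr_ge0.
rewrite -!ge0_integralZl// -ge0_integralD//.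
- apply: eq_integral => p _; rewrite -!EFinM -EFinD /mix; congr (_%:E).
  by ring.
- by move=> p _; rewrite mule_ge0.
- by apply: emeasurable_funM => //; exact: measurable_cst.
- by move=> p _; rewrite mule_ge0.
- by apply: emeasurable_funM => //; exact: measurable_cst.
Qed.

Lemma mix_density : even_density (mix t g1 g2).
Proof.
have [m1 p1 n1 i1] := g1D; have [m2 p2 n2 i2] := g2D.
split=> [|p|p|].
- by apply: measurable_funD; apply: measurable_funM => //; exact: measurable_cst.
- by rewrite addr_ge0// mulr_ge0// subr_ge0.
- by rewrite /mix n1 n2.
- rewrite (eq_integral (fun p => (1 * mix t g1 g2 p)%:E)); last first.
    by move=> p _; rewrite mul1r.
  rewrite (integral_mix (fun=> 1))//.
  under eq_integral do rewrite mul1r.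
  under [X in (_ + _ * X)%E]eq_integral do rewrite mul1r.
  by rewrite i1 i2 !mule1 -EFinD subrK.
Qed.

(** With this affine dependence on [t], making the energy exactly 0 is a linear equation. *)
Lemma kinetic_mix :
  (kinetic (mix t g1 g2) = (1 - t)%:E * kinetic g1 + t%:E * kinetic g2)%E.
Proof.
by apply: integral_mix => [|p]; [exact: measurable_sqrt1enorm|exact: sqrtr_ge0].
Qed.

Lemma cubic_moment_mix_lty : (cubic_moment g1 < +oo)%E -> (cubic_moment g2 < +oo)%E ->
  (cubic_moment (mix t g1 g2) < +oo)%E.
Proof.
have [_ p1 _ _] := g1D; have [_ p2 _ _] := g2D => c1 c2.
rewrite /cubic_moment integral_mix; last 2 first.
- exact: measurable_cube1enorm.
- by move=> p; rewrite exprn_ge0// addr_ge0// enorm_ge0.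
by rewrite lte_add_pinfty// lte_mul_pinfty ?lee_fin ?subr_ge0.
Qed.

Lemma ge_mixl p : (1 - t) * g1 p <= mix t g1 g2 p.
Proof. by have [_ p2 _ _] := g2D; rewrite lerDl mulr_ge0. Qed.

Lemma ge_mixr p : t * g2 p <= mix t g1 g2 p.
Proof. by have [_ p1 _ _] := g1D; rewrite lerDr mulr_ge0// subr_ge0. Qed.

End Mixture.

(** * Quantitative bounds for Gaussians *)

Section GaussEstimates.
Context {R : realType}.
Notation V3 := (vec3 (measurableTypeR R)).
Local Open Scope ring_scope.
Implicit Types s : R.

Lemma gauss3_density s : 0 < s -> even_density (gauss3 s).
Proof.
move=> s0; split.
- exact: measurable_gauss3.
- exact: gauss3_ge0.
- exact: gauss3N.
- by apply: integral_gauss3; rewrite gt_eqF.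
Qed.

(** By [gauss3_spread] the integrand is at most c 2^(3/2) times a Gaussian density of mass 1, and
    2^(3/2) <= 3. *)
Lemma integral_gauss3_le s (a : V3 -> R) (c : R) :
  0 < s -> 0 <= c -> measurable_fun setT a -> (forall p, 0 <= a p) ->
  (forall p, a p <= c * expR (dot p p / (4 * s ^+ 2))) ->
  (\int[lebesgue3]_p (a p * gauss3 s p)%:E <= (3 * c)%:E)%E.
Proof.
move=> s0 c0 ma a0 ac.
have q0 : 0 < Num.sqrt 2 * s by rewrite mulr_gt0// sqrtr_gt0.
have mg r : measurable_fun setT (fun p : V3 => gauss3 r p) by exact: measurable_gauss3.
have k3 : Num.sqrt 2 ^+ 3 <= 3 :> R.
  have e2 : Num.sqrt 2 ^+ 2 = 2 :> R by rewrite sqr_sqrtr.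
  have e0 : 0 <= Num.sqrt 2 :> R by exact: sqrtr_ge0.
  rewrite exprS e2; nra.
apply: (@le_trans _ _ (\int[lebesgue3]_p ((c * Num.sqrt 2 ^+ 3)%:E *
    (gauss3 (Num.sqrt 2 * s) p)%:E))%E).
  apply: ge0_le_integral => //.
  - by move=> p _; rewrite lee_fin mulr_ge0// gauss3_ge0.
  - by apply/measurable_EFinP; exact: measurable_funM.
  - apply: emeasurable_funM; first exact: measurable_cst.
    exact/measurable_EFinP.
  - move=> p _; rewrite -EFinM lee_fin -[leRHS]mulrA -gauss3_spread//.
    by rewrite [leRHS]mulrCA [leLHS]mulrC ler_wpM2l ?gauss3_ge0.
rewrite ge0_integralZl//.
- rewrite [X in (_ * X)%E](_ : _ = 1%E); last by apply: integral_gauss3; rewrite gt_eqF.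
  by rewrite mule1 lee_fin mulrC ler_wpM2r.
- exact/measurable_EFinP.
- by move=> p _; rewrite lee_fin gauss3_ge0.
- by rewrite lee_fin mulr_ge0// exprn_ge0// sqrtr_ge0.
Qed.

(** With D = |p|^2 and s >= 1, sqrt(1 + D) <= 2 s (1 + D / (4 s^2)), and 1 + x <= e^x; the previous
    bound applies with c = 2 s. *)
Lemma kinetic_gauss3_le s : 1 <= s -> (kinetic (gauss3 s) <= (6 * s)%:E)%E.
Proof.
move=> s1; have s0 : 0 < s by exact: lt_le_trans s1.
rewrite (_ : 6 * s = 3 * (2 * s)); last by ring.
apply: integral_gauss3_le => //.
- by rewrite mulr_ge0// ltW.
- exact: measurable_sqrt1enorm.
move=> p; rewrite sqr_enorm; have D0 := dot_ge0 p; move: D0; set D := dot p p => D0.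
apply: (@le_trans _ _ (2 * s * (1 + D / (4 * s ^+ 2)))); last first.
  by rewrite ler_pM2l ?mulr_gt0// expR_ge1Dx.
have r0 : 0 <= 2 * s * (1 + D / (4 * s ^+ 2)).
  apply: mulr_ge0; first by rewrite mulr_ge0// ltW.
  apply: addr_ge0 => //; apply: divr_ge0 => //; apply: mulr_ge0 => //.
  exact: sqr_ge0.
rewrite -[leRHS]ger0_norm// -sqrtr_sqr ler_wsqrtr//.
rewrite [leRHS](_ : _ = 4 * s ^+ 2 + 2 * D + (D / (2 * s)) ^+ 2); last first.
  by field; rewrite gt_eqF.
have := sqr_ge0 (D / (2 * s)); nra.
Qed.

Lemma cubic_moment_gauss3_lty s : 0 < s -> (cubic_moment (gauss3 s) < +oo)%E.
Proof.
move=> s0; set A := 1 + 8 * s ^+ 2.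
have A0 : 0 < A by rewrite addr_gt0// mulr_gt0// exprn_gt0.
apply: (@le_lt_trans _ _ (3 * (4 * A ^+ 2))%:E); last exact: ltry.
apply: integral_gauss3_le => //.
- by rewrite mulr_ge0// sqr_ge0.
- exact: measurable_cube1enorm.
- by move=> p; rewrite exprn_ge0// addr_ge0// enorm_ge0.
move=> p; have e0 := enorm_ge0 p; have D0 := dot_ge0 p.
rewrite -sqr_enorm; move: e0; set e := enorm p => e0.
(* An even power gives a polynomial in e^2: (1 + e)^3 <= (1 + e)^4 <= 4 (1 + e^2)^2. *)
apply: (@le_trans _ _ (4 * (1 + e ^+ 2) ^+ 2)).
  apply: (@le_trans _ _ ((1 + e) ^+ 4)).
    by rewrite ler_weXn2l// lerDl.
  rewrite [leRHS](_ : _ = (2 * (1 + e ^+ 2)) ^+ 2); last by ring.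
  rewrite [leLHS](_ : _ = ((1 + e) ^+ 2) ^+ 2); last by ring.
  rewrite lerXn2r ?nnegrE ?sqr_ge0 ?mulr_ge0 ?addr_ge0 ?sqr_ge0//.
  have := sqr_ge0 (1 - e); nra.
(* Taking the exponential as a square reduces the claim to 1 + e^2 <= A (1 + e^2 / (8 s^2)), which
   explains the choice of [A]. *)
have -> : expR (e ^+ 2 / (4 * s ^+ 2)) = expR (e ^+ 2 / (8 * s ^+ 2)) ^+ 2.
  by rewrite -expRM_natl; congr expR; field; rewrite gt_eqF.
rewrite -mulrA -exprMn ler_pM2l// lerXn2r ?nnegrE ?addr_ge0 ?sqr_ge0//.
  by rewrite mulr_ge0 ?expR_ge0// ltW.
apply: (@le_trans _ _ (A * (1 + e ^+ 2 / (8 * s ^+ 2)))); last first.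
  by rewrite ler_pM2l// expR_ge1Dx.
rewrite [leRHS](_ : _ = A + e ^+ 2 + e ^+ 2 / (8 * s ^+ 2)); last first.
  by rewrite /A; field; rewrite gt_eqF.
have : 0 <= e ^+ 2 / (8 * s ^+ 2) by rewrite divr_ge0 ?sqr_ge0// mulr_ge0// sqr_ge0.
have := sqr_ge0 s; rewrite /A; lra.
Qed.

(** The value of the unit Gaussian at the far corner (2, 2, 2) of the cube [1, 2]^3. *)
Definition gauss3_cst : R := normal_peak 1 ^+ 3 * expR (- 6).

Lemma gauss3_cst_gt0 : 0 < gauss3_cst.
Proof. by rewrite mulr_gt0 ?expR_gt0// exprn_gt0// normal_peak_gt0// oner_eq0. Qed.

Definition diag (c : R) : vec3 R := ((c, c), c).

Lemma cube_diagP c w (p : V3) : cube (diag c) w p ->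
  [/\ c <= p.1.1 <= c + w, c <= p.1.2 <= c + w & c <= p.2 <= c + w].
Proof. by move=> [[/=]]; rewrite !in_itv/=. Qed.

(** The two choices of [c] give the opposite cubes [s, 2 s]^3 and [-2 s, -s]^3. Opposite signs
    provide both negative scalar products and pairs of separated points. *)
Lemma gauss3_cube_ge s c p : 0 < s -> c = s \/ c = - (2 * s) ->
  cube (diag c) s p -> gauss3_cst / s ^+ 3 <= gauss3 s p.
Proof.
move=> s0 cs /cube_diagP[/andP[a1 b1] /andP[a2 b2] /andP[a3 b3]].
apply: gauss3_lb => //.
have H (x : R) : c <= x -> x <= c + s -> x * x <= 4 * s ^+ 2.
  by case: cs => -> h1 h2; nra.
have := H _ a1 b1; have := H _ a2 b2; have := H _ a3 b3; rewrite /dot; nra.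
Qed.

(** On [s, 2 s]^3, of volume s^3, the kinetic weight is at least s. *)
Lemma kinetic_gauss3_ge s : 0 < s -> ((gauss3_cst * s)%:E <= kinetic (gauss3 s))%E.
Proof.
move=> s0; have k0 := gauss3_cst_gt0.
have -> : gauss3_cst * s = s * (gauss3_cst / s ^+ 3) * s ^+ 3.
  by field; rewrite gt_eqF.
apply: (le_integral_cube3 (diag s)); first exact: ltW.
- by rewrite mulr_ge0 ?divr_ge0 ?exprn_ge0 ?ltW.
- apply/measurable_EFinP; apply: measurable_funM; first exact: measurable_sqrt1enorm.
  exact: measurable_gauss3.
- by move=> p; rewrite lee_fin mulr_ge0 ?sqrtr_ge0 ?gauss3_ge0.
move=> p cp; rewrite lee_fin ler_pM//.
- exact: ltW.
- by rewrite divr_ge0 ?exprn_ge0 ?ltW.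
- have [/andP[a1 b1] /andP[a2 b2] /andP[a3 b3]] := cube_diagP _ _ _ cp.
  rewrite -[leLHS]gtr0_norm// -sqrtr_sqr ler_wsqrtr// sqr_enorm /dot.
  have H (x : R) : s <= x -> s ^+ 2 <= x * x by move=> h1; nra.
  have := H _ a1; have := H _ a2; have := H _ a3; nra.
- by apply: (gauss3_cube_ge _ s) => //; left.
Qed.

Lemma class_C1_gauss3 {V : normedModType R} s (l : V -> vec3 R) :
  class_C1 (fun x => dot (l x) (l x)) -> class_C1 (fun x => gauss3 s (l x)).
Proof.
move=> Cl; rewrite /gauss3; apply: class_C1M; first exact: class_C1_cst.
apply: class_C1_expR.
rewrite (_ : (fun x => _) = (fun x => - (s ^+ 2 *+ 2)^-1 * dot (l x) (l x))).
  by apply: class_C1M => //; exact: class_C1_cst.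
by apply/funext => x; rewrite !mulNr mulrC.
Qed.

Lemma class_C1_tilt {V : normedModType R} (g : V -> R) :
  class_C1 g -> class_C1 (fun x => tilt (g x)).
Proof.
move=> Cg; rewrite /tilt; apply: class_C1M; first exact: class_C1_cst.
apply: class_C1V => [x|]; first by rewrite gt_eqF// expRD1_gt0.
by apply: class_C1D; [exact: class_C1_cst|exact: class_C1_expR].
Qed.

End GaussEstimates.

(** * Two-scale Gaussian mixtures *)

Section Example.
Context {R : realType}.
Notation V3 := (vec3 (measurableTypeR R)).
Local Open Scope ring_scope.
Notation kappa := (@gauss3_cst R).

(** Serves for both factors: [rho] has weight 1/2 and a small [s], [h] a weight adjusted to the
    energy and a large [s]. *)
Definition two_scale (t s : R) : V3 -> R := mix t (gauss3 1) (gauss3 s).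

Lemma two_scale_density t s : 0 <= t -> t <= 1 -> 0 < s ->
  even_density (two_scale t s).
Proof. by move=> t0 t1 s0; apply: mix_density => //; exact: gauss3_density. Qed.

Lemma class_C1_two_scale {V : normedModType R} t s (l : V -> vec3 R) :
  class_C1 (fun x => dot (l x) (l x)) -> class_C1 (fun x => two_scale t s (l x)).
Proof.
move=> Cl; apply: class_C1D; apply: class_C1M;
  by [exact: class_C1_cst|exact: class_C1_gauss3].
Qed.

Lemma two_scale_rotv t s O p : rotation O -> two_scale t s (rotv O p) = two_scale t s p.
Proof. by move=> rO; rewrite /two_scale /mix /gauss3 !dot_rotv. Qed.

Lemma cubic_moment_two_scale t s : 0 <= t -> t <= 1 -> 0 < s ->
  (cubic_moment (two_scale t s) < +oo)%E.
Proof.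
by move=> t0 t1 s0; apply: cubic_moment_mix_lty => //;
  [exact: gauss3_density|exact: gauss3_density|
   exact: cubic_moment_gauss3_lty|exact: cubic_moment_gauss3_lty].
Qed.

Lemma interaction_two_scale_lty s : 0 < s ->
  (interaction (two_scale 2^-1 s) < +oo)%E.
Proof.
move=> s0; apply: (interaction_lty _ (normal_peak 1 ^+ 3 + normal_peak s ^+ 3)).
  by apply: two_scale_density => //; lra.
move=> q; rewrite /two_scale /mix.
have := gauss3_ub 1 q; have := gauss3_ub s q.
have := gauss3_ge0 1 q; have := gauss3_ge0 s q; lra.
Qed.

(** Points of the two opposite core cubes have coordinate differences between 2 s and 4 s, so their
    distance is at most sqrt 48 s < 7 s; the two weights 1/2 turn 7 into 28. *)
Lemma interaction_two_scale_ge s : 0 < s ->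
  ((kappa ^+ 2 / (28 * s))%:E <= interaction (two_scale 2^-1 s))%E.
Proof.
move=> s0; have k0 := @gauss3_cst_gt0 R.
have D1 := @gauss3_density R _ ltr01; have Ds := gauss3_density _ s0.
have D : even_density (two_scale 2^-1 s) by apply: two_scale_density => //; lra.
pose c := (2^-1 * (kappa / s ^+ 3)) ^+ 2 / (7 * s).
have -> : kappa ^+ 2 / (28 * s) = c * (s ^+ 3 * s ^+ 3).
  by rewrite /c; field; rewrite gt_eqF.
have k3 : 0 <= 2^-1 * (kappa / s ^+ 3).
  by rewrite mulr_ge0// divr_ge0 ?exprn_ge0 ?ltW.
have s7 : 0 < 7 * s by rewrite mulr_gt0.
apply: (interaction_ge _ D (diag s) (diag (- (2 * s)))).
- exact: ltW.
- by rewrite divr_ge0 ?exprn_ge0// ltW.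
move=> q q' cq cq'.
have lb a p : a = s \/ a = - (2 * s) -> cube (diag a) s p ->
    2^-1 * (kappa / s ^+ 3) <= two_scale 2^-1 s p.
  move=> ha ca; apply: (le_trans _ (ge_mixr _ _ _ _ D1 _)); last by lra.
  by rewrite ler_pM2l ?invr_gt0//; exact: (gauss3_cube_ge _ a).
have [/andP[a1 b1] /andP[a2 b2] /andP[a3 b3]] := cube_diagP _ _ _ cq.
have [/andP[a1' b1'] /andP[a2' b2'] /andP[a3' b3']] := cube_diagP _ _ _ cq'.
have H (x y : R) : s <= x -> x <= s + s -> - (2 * s) <= y -> y <= - (2 * s) + s ->
    4 * s ^+ 2 <= (y - x) * (y - x) <= 16 * s ^+ 2.
  by move=> *; apply/andP; split; nra.
have /andP[l1 u1] := H _ _ a1 b1 a1' b1'.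
have /andP[l2 u2] := H _ _ a2 b2 a2' b2'.
have /andP[l3 u3] := H _ _ a3 b3 a3' b3'.
have s2 : 0 < s ^+ 2 by rewrite exprn_gt0.
set d := (q' : vec3 R) - q.
have dd : 0 < dot d d by rewrite /dot /d/=; lra.
have dd' : dot d d <= (7 * s) ^+ 2 by rewrite exprMn /dot /d/=; lra.
have e0 : 0 < enorm d by rewrite sqrtr_gt0.
have e7 : enorm d <= 7 * s.
  by rewrite -[leRHS]gtr0_norm// -sqrtr_sqr ler_wsqrtr.
rewrite /c ler_pM//.
- exact: exprn_ge0.
- by rewrite invr_ge0 ltW.
- rewrite expr2 ler_pM//; first by apply: (lb s) => //; left.
  by apply: (lb (- (2 * s))) => //; right.
- by rewrite lef_pV2 ?posrE.
Qed.

End Example.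

(** * Choice of the parameters and verification *)

Theorem mainTheorem1 (R : realType) :
  exists f0 : phase R -> R,
    [/\ P3C1 f0,
        spherically_symmetric f0,
        energy f0 = 0,
        virial f0 < (- 2^-1)%:E
      & ((3 / 8) * (15 / 16) `^ (3^-1))%:E < 'N[lebesgue6]_(3 / 2)%:E [EFin \o f0] ].
Proof.
pose kappa := @gauss3_cst R.
have k0 : (0 < kappa)%R by exact: gauss3_cst_gt0.
(* With e = 1 / lam, the term 4 / kappa^2 serves the 3/2-norm and the last term makes the potential
   energy at least 6 + 12 / kappa^2. *)
pose lam : R := (1 + 4 / kappa ^+ 2 + 56 * (6 + 12 / kappa ^+ 2) / kappa ^+ 2)%R.
have k2 : (0 < kappa ^+ 2)%R by rewrite exprn_gt0.
have A0 : (0 < 4 / kappa ^+ 2)%R by rewrite divr_gt0.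
have B0 : (0 < 12 / kappa ^+ 2)%R by rewrite divr_gt0.
have C0 : (0 < 56 * (6 + 12 / kappa ^+ 2) / kappa ^+ 2)%R.
  by rewrite divr_gt0// mulr_gt0// addr_gt0.
have lam0 : (0 < lam)%R by rewrite /lam !addr_gt0.
pose e := (lam^-1)%R.
have e0 : (0 < e)%R by rewrite invr_gt0.
pose rho := @two_scale R (2^-1)%R e.
have rhoD : even_density rho by apply: two_scale_density => //; lra.
have D1 := @gauss3_density R _ ltr01.
have De := gauss3_density _ e0.
have I1 := interaction_two_scale_ge _ e0.
have I2 := interaction_two_scale_lty _ e0.
have IF : interaction rho \is a fin_num.
  rewrite ge0_fin_numE//; apply: le_trans I1.
  by rewrite lee_fin divr_ge0 ?sqr_ge0// mulr_ge0// ltW.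
(* The potential energy is -u, so zero energy means kinetic energy [u]. *)
pose u := (2^-1 * fine (interaction rho))%R.
have Iu : interaction rho = (2 * u)%:E.
  by rewrite /u mulrA divff// mul1r fineK.
(* The 6 bounds the kinetic energy of the unit Gaussian; 12 / kappa^2 is the surplus spent on the
   virial. *)
have u_ge : (6 + 12 / kappa ^+ 2 <= u)%R.
  have : (kappa ^+ 2 / (28 * e) <= 2 * u)%R by rewrite -lee_fin -Iu.
  have -> : (kappa ^+ 2 / (28 * e) = 2 * (kappa ^+ 2 / 56 * lam))%R.
    by rewrite /e; field; rewrite gt_eqF.
  rewrite ler_pM2l//; apply: le_trans.
  have -> : (6 + 12 / kappa ^+ 2 =
      kappa ^+ 2 / 56 * (56 * (6 + 12 / kappa ^+ 2) / kappa ^+ 2))%R.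
    by field; rewrite gt_eqF.
  rewrite ler_pM2l ?divr_gt0// /lam; lra.
(* This makes the fast kinetic energy, at least kappa P, exceed 2 u, whence t <= 1/2. *)
pose P := (1 + 2 * u / kappa)%R.
have uk0 : (0 < 2 * u / kappa)%R by rewrite divr_gt0// mulr_gt0//; lra.
have P1 : (1 <= P)%R by rewrite /P; lra.
have P0 : (0 < P)%R by exact: lt_le_trans P1.
have kP : (2 * u <= kappa * P)%R.
  have -> : (kappa * P = kappa + 2 * u)%R by rewrite /P; field; rewrite gt_eqF.
  lra.
have DP := gauss3_density _ P0.
have kin_fin s : (1 <= s)%R -> kinetic (@gauss3 R s) \is a fin_num.
  move=> s1; have s0 : (0 < s)%R by exact: lt_le_trans s1.
  rewrite ge0_fin_numE; last first.
    by apply: le_trans (kinetic_gauss3_ge _ s0); rewrite lee_fin mulr_ge0// ltW.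
  exact: le_lt_trans (kinetic_gauss3_le _ s1) (ltry _).
pose T0 := fine (kinetic (@gauss3 R 1)).
pose T1 := fine (kinetic (@gauss3 R P)).
have T0E : kinetic (@gauss3 R 1) = T0%:E by rewrite fineK// kin_fin.
have T1E : kinetic (@gauss3 R P) = T1%:E by rewrite fineK// kin_fin.
have T0_le : (T0 <= 6)%R by rewrite -lee_fin -T0E -[6%R]mulr1 kinetic_gauss3_le.
have T0_ge : (0 <= T0)%R.
  rewrite -lee_fin -T0E; apply: le_trans (kinetic_gauss3_ge _ ltr01).
  by rewrite lee_fin mulr_ge0// ltW.
have T1_le : (T1 <= 6 * P)%R by rewrite -lee_fin -T1E kinetic_gauss3_le.
have T1_ge : (2 * u <= T1)%R.
  by apply: le_trans kP _; rewrite -lee_fin -T1E kinetic_gauss3_ge.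
have T10 : (0 < T1 - T0)%R by lra.
(* The root of (1 - t) T0 + t T1 = u. *)
pose t := ((u - T0) / (T1 - T0))%R.
have t0 : (0 <= t)%R by rewrite divr_ge0//; lra.
have t12 : (t <= 2^-1)%R by rewrite ler_pdivrMr//; lra.
have t1 : (t <= 1)%R by lra.
(* Follows from T1 - T0 <= 6 P and u - T0 >= u - 6. *)
have tP : ((u - 6) / 6 <= P * t)%R.
  rewrite /t mulrA ler_pdivlMr//.
  apply: (@le_trans _ _ ((u - 6) * P)%R).
    rewrite mulrAC ler_pdivrMr// -mulrA ler_wpM2l//; lra.
  by rewrite mulrC ler_wpM2l//; [exact: ltW|lra].
pose h := @two_scale R t P.
have hD : even_density h by exact: two_scale_density.
have half (c : R) (p : vec3 (measurableTypeR R)) :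
  c = e \/ c = (- (2 * e))%R -> cube (diag c) e p ->
  (2^-1 * (kappa / e ^+ 3) <= rho p)%R.
  move=> hc cp; apply: (le_trans _ (ge_mixr _ _ _ _ D1 _)); last by lra.
  by rewrite ler_pM2l ?invr_gt0//; exact: (gauss3_cube_ge _ c).
exists (tilted h rho); split.
- split.
  + exact: tilted_ge0.
  + apply: class_C1M; last by apply: class_C1_tilt; exact: class_C1_dot_fst_snd.
    apply: class_C1M.
      by apply: (class_C1_two_scale _ _ fst); exact: class_C1_dot_fst.
    by apply: (class_C1_two_scale _ _ snd); exact: class_C1_dot_snd.
  + exact: integral_tilted_eq1.
  + move=> k /andP[_ k3]; apply: moment_tilted => //.
      exact: cubic_moment_two_scale.
    by apply: cubic_moment_two_scale => //; lra.
- by move=> O rO p q; rewrite /tilted/= dot_rotv// /h /rho !two_scale_rotv.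
- rewrite energy_tilted// Iu /h /two_scale kinetic_mix// T0E T1E.
  rewrite -[LHS]/(((1 - t) * T0 + t * T1 - 2^-1 * (2 * u))%R%:E); congr (_%:E).
  rewrite /t; field; rewrite gt_eqF//.
(* The positive part costs at most 2, so the cubes have to contribute 3. For p in [P, 2 P]^3 and q
   in [-2, -1]^3 one has p . q <= -3 P; the fast part of [h] gives t kappa / P^3 and the unit cloud
   of [rho] gives kappa / 2. *)
- apply: (@le_lt_trans _ _ (2 - 3)%:E); last by rewrite lte_fin; lra.
  pose c := (3 * P * (t * (kappa / P ^+ 3) * (2^-1 * kappa)))%R.
  have kP3 : (0 <= kappa / P ^+ 3)%R by rewrite divr_ge0 ?exprn_ge0 ?ltW.
  have tk : (0 <= t * (kappa / P ^+ 3))%R by rewrite mulr_ge0.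
  have hk : (0 <= 2^-1 * kappa)%R by rewrite mulr_ge0// ltW.
  have P3 : (0 <= 3 * P)%R by rewrite mulr_ge0// ltW.
  have tkhk := mulr_ge0 tk hk.
  have c0 : (0 <= c)%R by rewrite /c mulr_ge0.
  apply: (le_trans (virial_tilted_le _ _ hD rhoD (diag P) (diag (- 2)) P 1 c _ _ _ _)).
  + exact: ltW.
  + exact: ler01.
  + exact: c0.
  + move=> p q cp cq.
    have [/andP[a1 b1] /andP[a2 b2] /andP[a3 b3]] := cube_diagP _ _ _ cp.
    have [/andP[a1' b1'] /andP[a2' b2'] /andP[a3' b3']] := cube_diagP _ _ _ cq.
    have H (x y : R) : (P <= x -> y <= - 2 + 1 -> x * y <= - P)%R.
      by move=> *; nra.
    have dle : (dot p q <= - (3 * P))%R.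
      have := H _ _ a1 b1'; have := H _ _ a2 b2'; have := H _ _ a3 b3'.
      by rewrite /dot; lra.
    split; first by apply: (le_trans dle); rewrite oppr_le0 mulr_ge0// ltW.
    rewrite /c ler_pM//; first by rewrite lerNr.
    rewrite ler_pM//.
    * apply: (le_trans _ (ge_mixr _ _ _ t1 D1 _)).
      by rewrite ler_wpM2l//; apply: (gauss3_cube_ge _ P) => //; left.
    have -> : (2^-1 * kappa = (1 - 2^-1) * (kappa / 1 ^+ 3))%R by field.
    apply: (le_trans _ (ge_mixl _ _ _ _ De _)); last by rewrite invr_ge0.
    rewrite ler_wpM2l//; first by lra.
    by apply: (gauss3_cube_ge _ (- 2)%R) => //; right; rewrite mulr1.
  rewrite lee_fin lerD2l lerN2.
  (* The momentum volume P^3 cancels the height of the fast Gaussian; by [tP] and [u_ge] the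
     remainder is at least 3. *)
  have -> : (c * (P ^+ 3 * 1 ^+ 3) = 3 / 2 * kappa ^+ 2 * (P * t))%R.
    by rewrite /c; field; rewrite gt_eqF.
  have : (3 / 2 * kappa ^+ 2 * ((u - 6) / 6) <= 3 / 2 * kappa ^+ 2 * (P * t))%R.
    by rewrite ler_pM2l// mulr_gt0.
  apply: le_trans.
  have : (kappa ^+ 2 * (12 / kappa ^+ 2) <= kappa ^+ 2 * (u - 6))%R.
    by rewrite ler_pM2l//; lra.
  have -> : (kappa ^+ 2 * (12 / kappa ^+ 2) = 12)%R by field; rewrite gt_eqF.
  lra.
(* The required constant is at most 3/8, so a norm of at least 1 is enough. *)
- apply: (@lt_le_trans _ _ 1).
    rewrite lte_fin.
    have : ((15 / 16) `^ 3^-1 <= 1 :> R)%R.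
      apply: (@le_trans _ _ (1 `^ 3^-1)%R); last by rewrite powR1.
      by rewrite ge0_ler_powR ?nnegrE//; lra.
    have := powR_ge0 (15 / 16 : R)%R (3^-1)%R; lra.
  (* The height lam^2 matches the phase volume e^3 = 1 / lam^3, since (lam^2)^(3/2) = lam^3. Slow
     momenta in [1, 2]^3 face core positions in [-2 e, -e]^3, so the tilt is at least 1. *)
  apply: (Lnorm32_ge1 (diag 1) (diag (- (2 * e))) 1 e (lam ^+ 2)%R).
  + exact: ler01.
  + exact: ltW.
  + exact: sqr_ge0.
  + exact: measurable_tilted.
  + exact: tilted_ge0.
  + move=> p q cp cq.
    have [/andP[a1 b1] /andP[a2 b2] /andP[a3 b3]] := cube_diagP _ _ _ cp.
    have [/andP[a1' b1'] /andP[a2' b2'] /andP[a3' b3']] := cube_diagP _ _ _ cq.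
    have H (x y : R) : (1 <= x -> y <= - (2 * e) + e -> x * y <= 0)%R.
      by move=> *; nra.
    have d0 : (dot p q <= 0)%R.
      have := H _ _ a1 b1'; have := H _ _ a2 b2'; have := H _ _ a3 b3'.
      by rewrite /dot; lra.
    have q2 := half _ _ (or_intror erefl) cq.
    have p2 : (2^-1 * kappa <= h p)%R.
      have -> : (kappa = kappa / 1 ^+ 3)%R by field.
      apply: (le_trans _ (ge_mixl _ _ _ t0 DP _)).
      rewrite ler_pM//; first by rewrite divr_ge0// ltW.
        by lra.
      by apply: (gauss3_cube_ge _ 1%R) => //; left.
    have hk : (0 <= 2^-1 * kappa)%R by rewrite mulr_ge0// ltW.
    have he : (0 <= 2^-1 * (kappa / e ^+ 3))%R.
      by rewrite mulr_ge0// divr_ge0 ?exprn_ge0 ?ltW.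
    apply: (@le_trans _ _ (2^-1 * kappa * (2^-1 * (kappa / e ^+ 3)) * 1)%R); last first.
      have hh := mulr_ge0 hk he.
      by rewrite /tilted ler_pM// ?tilt_ge1// ler_pM.
    (* The density is at least kappa^2 lam^3 / 4, and lam >= 4 / kappa^2 leaves lam^2. *)
    have -> : (2^-1 * kappa * (2^-1 * (kappa / e ^+ 3)) * 1 =
        lam ^+ 2 * (kappa ^+ 2 / 4 * lam))%R.
      by rewrite /e; field; rewrite gt_eqF.
    rewrite ler_peMr ?sqr_ge0//.
    rewrite [leLHS](_ : _ = kappa ^+ 2 / 4 * (4 / kappa ^+ 2))%R; last first.
      by field; rewrite gt_eqF.
    rewrite ler_pM2l ?divr_gt0// /lam; lra.
  + rewrite -powR_mulrn ?(ltW lam0)// -powRrM.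
    rewrite (_ : 2%:R * (3 / 2) = 3%:R)%R; last by field.
    rewrite powR_mulrn ?(ltW lam0)// expr1n mul1r /e -exprMn divff ?expr1n//.
    by rewrite gt_eqF.
Qed.
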